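(* Let $\sigma\in(0,1/3)$, let $f\in L^2_\rho(0,\infty)$ with $\sqrt{x}\,f'\in L^2_\rho(0,\infty)$, and let $(p_j)_{j\ge1}$ be a sequence of pairwise distinct real numbers with $p_j>1/2$ and $$\left|1-\frac1{p_j}\right|\le\sigma\qquad(j=1,2,\dots).$$ Let $\theta_0$ be the unique solution $x$ of the equation $\dfrac{2\sigma^{1-x}}{1-\sigma}=1$. Let $\psi:[0,\infty)\to\mathbb{R}$ be a (strictly) increasing function with $\psi(m)\ge mD_m$ for all $m=1,2,\dots$. Let $\epsilon>0$ be such that $\epsilon^{-3/4}$ lies in the range of $\psi$ and $$m(\epsilon)=\left[\psi^{-1}(\epsilon^{-3/4})\right]-1$$ satisfies $m(\epsilon)\ge1$, where $[x]$ is the greatest integer $\le x$. Let $(\mu_j^\epsilon)_{j\ge1}$ be a sequence of real numbers satisfying $$\sup_j\left|p_j\big(\mathcal{L}f(p_j)-\mu^\epsilon_j\big)\right|<\epsilon,$$ and put $\nu^\epsilon_j=p_j\mu^\epsilon_j$ for $j=1,2,\dots$. Then for every $\theta\in(0,\theta_0)$, $$\left\|f-\Phi^{-1}L^\theta_{m(\epsilon)}(\nu^\epsilon)\right\|^2_{L^2_\rho}\le 2(1+m(\epsilon)\theta)^2\,\|f\|^2_{L^2_\rho}\left(\frac{2\sigma^{1-\theta}}{1-\sigma}\right)^{2m(\epsilon)}+\frac{2}{m(\epsilon)\theta}\,\|\sqrt{x}\,f'\|^2_{L^2_\rho}+2\epsilon^{1/2}.$$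
   Context: $L^2_\rho(0,\infty)$ is the Hilbert space of real Lebesgue measurable functions $f$ on $(0,\infty)$ with $\|f\|^2_{L^2_\rho}=\int_0^\infty |f(x)|^2e^{-x}\,dx<\infty$. $f'$ denotes the (weak) derivative of $f$ on $(0,\infty)$. For $p>1/2$, $\mathcal{L}f(p)=\int_0^\infty e^{-px}f(x)\,dx$. $L_k(x)=\frac{e^x}{k!}\frac{d^k}{dx^k}(e^{-x}x^k)$, $k=0,1,2,\dots$, are the Laguerre polynomials. Put $\alpha_j=1-1/p_j$ and $\omega_m(z)=(z-\alpha_1)\cdots(z-\alpha_m)$. For $m\ge1$, $$D_m=\max_{1\le n\le m}\ \max_{|z|\le1}\left|\frac{\omega_m(z)}{(z-\alpha_n)\,\omega_m'(\alpha_n)}\right|\qquad(z\in\mathbb{C}),$$ where the quotient is understood as a polynomial in $z$. For $m\ge1$ and a real sequence $\nu=(\nu_j)_{j\ge1}$ (only $\nu_1,\dots,\nu_m$ are used), $\ell^{(m)}_k(\nu)$ denotes the coefficient of $z^k$ in the Lagrange interpolation polynomial, i.e. the unique polynomial $P$ of degree at most $m-1$ with $P(\alpha_j)=\nu_j$ for $1\le j\le m$. The truncated Lagrange polynomial is $L^\theta_m(\nu)(z)=\sum_{0\le k\le\theta(m-1)}\ell^{(m)}_k(\nu)z^k$. $\Phi$ is the linear map sending $\sum_{k\ge0} a_kL_k\in L^2_\rho(0,\infty)$ to the power series $\sum_{k\ge0} a_kz^k$; thus $\Phi^{-1}L^\theta_m(\nu)=\sum_{0\le k\le\theta(m-1)}\ell^{(m)}_k(\nu)L_k$.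 *)

(* Defs.v *)
From HB Require Import structures.
From mathcomp Require Import all_boot all_order all_algebra.
From mathcomp Require Import qpoly.
From mathcomp Require Import all_classical all_reals all_analysis.
From mathcomp Require Import complex.
Set Implicit Arguments.
Unset Strict Implicit.
Unset Printing Implicit Defensive.
Import Order.TTheory GRing.Theory Num.Theory.
Import numFieldNormedType.Exports.
Local Open Scope classical_set_scope.
Local Open Scope ring_scope.

(* [R] with the Lebesgue (Caratheodory) sigma-algebra instead of the Borel one;
   its underlying type is convertible to [R]. *)
Notation lebesgueType R :=
  (caratheodory_type ((@wlength R idfun)^*)%mu).
Notation leb R := (@completed_lebesgue_measure R).

Section L2rho.
Context {R : realType}.
Implicit Types (f g phi : R -> R).

Definition halfline : set (lebesgueType R) := `]0%R, +oo[%classic.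

Definition lebesgue_measurable (D : set (lebesgueType R)) f : Prop :=
  measurable_fun D (f : lebesgueType R -> measurableTypeR R).

Definition L2rho_normsq f : \bar R :=
  (\int[leb R]_(x in halfline) (`|f x| ^+ 2 * expR (- x))%:E)%E.

Definition L2rho f : Prop :=
  lebesgue_measurable halfline f /\ (L2rho_normsq f < +oo)%E.

Definition locally_integrable_halfline f : Prop :=
  forall K : set R, compact K -> K `<=` halfline ->
    (leb R).-integrable (K : set (lebesgueType R)) (EFin \o f).

Definition supp phi : set R := closure [set x | phi x != 0].

Definition test_function phi : Prop :=
  [/\ forall (n : nat) (x : R), derivable (derive1n n phi) x 1,
      compact (supp phi) & supp phi `<=` halfline].

Definition weak_derivative f g : Prop :=
  [/\ locally_integrable_halfline f,
      locally_integrable_halfline g &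
      forall phi, test_function phi ->
        \int[leb R]_(x in halfline) (f x * derive1 phi x) =
        - \int[leb R]_(x in halfline) (g x * phi x)].

Definition laplace f (p : R) : R :=
  \int[leb R]_(x in halfline) (expR (- (p * x)) * f x).

Definition laguerre (k : nat) (x : R) : R :=
  expR x / k`!%:R * derive1n k (fun t : R => expR (- t) * t ^+ k) x.

(* Inverse of sum_k a_k L_k |-> sum_k a_k z^k, on polynomials; L_k = laguerre k. *)
Definition Phi_inv (P : {poly R}) : R -> R :=
  fun x => \sum_(k < size P) P`_k * laguerre k x.

End L2rho.

(* Sequences are indexed from 0: the j-th term here is the (j+1)-st term of a
   sequence indexed from 1. *)
Section Interpolation.
Context {R : realType}.
Implicit Types (a nu : nat -> R) (m n : nat).

Definition alpha (p : nat -> R) : nat -> R := fun j => 1 - (p j)^-1.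

Definition omega a m : {poly R} := \prod_(j < m) ('X - (a j)%:P).

(* omega_m(z) / ((z - a_n) omega_m'(a_n)) at a complex point z *)
Definition lagrange_quot a m n (z : R[i]) : R[i] :=
  (map_poly (real_complex R) (omega a m %/ ('X - (a n)%:P))).[z]
  / ((omega a m)^`()%R.[a n])%:C%C.

(* The supremum over the compact unit disc of the modulus of a polynomial is
   attained, hence is a maximum. *)
Definition interp_const a m : R :=
  \big[Num.max/0]_(n < m)
    sup [set Normc.normc (lagrange_quot a m n z) | z in [set z : R[i] | `|z| <= 1]].

Definition is_lagrange_interp a nu m (P : {poly R}) : Prop :=
  (size P <= m)%N /\ forall j, (j < m)%N -> P.[a j] = nu j.

Lemma is_lagrange_interp_exists a nu m : injective a ->
  exists P, is_lagrange_interp a nu m P.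
Proof.
move=> a_inj; case: m => [|m]; first by exists 0; rewrite /is_lagrange_interp size_poly0.
exists (\sum_(i < m.+1) (nu i)%:P * tnth (lagrange m.+1 a) i); split.
  apply: (leq_trans (size_sum _ _ _)); apply/bigmax_leqP => i _.
  rewrite mul_polyC; apply: leq_trans (size_scale_leq _ _) _.
  by rewrite size_lagrange_.
move=> j jm; rewrite horner_sum (bigD1 (Ordinal jm))//=.
have /= := lagrange_sample (ltn0Sn m) a_inj; move=> sample.
rewrite hornerM hornerC (sample (Ordinal jm) (Ordinal jm)) eqxx mulr1 big1 ?addr0//.
move=> i iN; rewrite hornerM (sample i (Ordinal jm)).
by rewrite (negbTE iN) mulr0.
Qed.

Lemma is_lagrange_interp_unique a nu m P Q : injective a ->
  is_lagrange_interp a nu m P -> is_lagrange_interp a nu m Q -> P = Q.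
Proof.
move=> a_inj [sP eP] [sQ eQ]; apply/eqP; rewrite -subr_eq0; apply/eqP.
apply: (@roots_geq_poly_eq0 _ _ [seq a i | i <- iota 0 m]).
- apply/allP => x /mapP[j]; rewrite mem_iota/= add0n => jm ->.
  by rewrite /root !hornerE eP// eQ// subrr.
- by rewrite map_inj_uniq// iota_uniq.
- rewrite size_map size_iota (leq_trans (size_polyD _ _))//.
  by rewrite size_polyN geq_max sP.
Qed.

Definition lagrange_interp a nu m : {poly R} :=
  xget 0 [set P | is_lagrange_interp a nu m P].

Lemma lagrange_interpP a nu m : injective a ->
  is_lagrange_interp a nu m (lagrange_interp a nu m).
Proof.
move=> /(@is_lagrange_interp_exists a nu m)[P aP].
exact: (xgetPex 0 (ex_intro _ P aP)).
Qed.

Definition truncated_lagrange (theta : R) a nu m : {poly R} :=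
  \sum_(k < m | k%:R <= theta * (m%:R - 1)) (lagrange_interp a nu m)`_k *: 'X^k.

End Interpolation.

(* Main.v *)
Require Import Defs.
From HB Require Import structures.
From mathcomp Require Import all_boot all_order all_algebra.
From mathcomp Require Import cyclic separable cyclotomic.
From mathcomp Require Import all_classical all_reals all_analysis.
From mathcomp Require Import measurable_realfun complex.
From mathcomp Require Import ring lra zify.
Set Implicit Arguments.
Unset Strict Implicit.
Unset Printing Implicit Defensive.
Import Order.TTheory GRing.Theory Num.Theory.
Import numFieldNormedType.Exports.
Local Open Scope classical_set_scope.
Local Open Scope ring_scope.

(** The Laguerre polynomials L_k form an orthonormal basis of the space L^2
    of (0,oo) with weight e^(-x).  Let a_k be the coefficients of f in this
    basis.  By Parseval the squared error is the sum of (a_k - l_k)^2 over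
    k <= theta (m-1), where l_k is the k-th coefficient of the interpolation
    polynomial of the noisy data, plus the sum of a_k^2 over the other k.

    The exponential e^(-(p-1)x) has Laguerre coefficients alpha^k / p with
    alpha = 1 - 1/p, so p Lf(p) = sum_k a_k alpha^k (laplace_pser): exact data
    are the values at the nodes alpha_j, |alpha_j| <= sigma, of the power series
    g(z) = sum_k a_k z^k.  Three estimates then give the three terms.

    - Interpolation error.  Newton's scheme writes g as its interpolation
      polynomial plus omega_m times a power series; every division by
      z - alpha_j multiplies a bound on the coefficients by 1/(1-sigma), and
      |a_k| <= ||f||.  The coefficients of omega_m of degree at most k add up
      to at most 2^m sigma^(m-k).  Hence for k <= theta m the k-th coefficient
      is wrong by at most ||f|| (2 sigma^(1-theta)/(1-sigma))^m
      (interp_coef_error_powR).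

    - Noise.  The interpolation polynomial of data bounded by eps is at most
      eps m D_m in modulus on the unit disc, so by Parseval on the m-th roots of
      unity its coefficients have squares summing to at most (eps m D_m)^2
      (interp_noise); the choice of m makes this at most eps^(1/2).

    - Tail.  As (x e^(-x) L_k')' = - k e^(-x) L_k, integration by parts shows
      that k a_k is the scalar product of f' and L_k' for the weight x e^(-x),
      for which the L_k' are orthogonal with squared norms k.  Bessel gives
      sum_k k a_k^2 <= ||sqrt(x) f'||^2 (sum_weighted_coef_le).  For a weak
      derivative the integration by parts is a limit over smooth cut-offs
      (weak_ibp).

    Completeness (laguerre_complete) rests on exponentials.  For q > -1/2 the
    squared Laguerre coefficients of e^(-qx) add up to its squared norm, so it
    lies in the closed span; hence so do the functions (1 - e^(-anx))^(n 2^n),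
    whose limits are indicators of half-lines.  The pi-lambda theorem and
    approximation by simple functions give the whole space. *)

(** * Laguerre polynomials and moments of exponential weights *)

Section LaguerrePoly.
Context {R : numFieldType}.
Implicit Types (P Q : {poly R}) (p : R).

(** e^x (e^(-x) Q)', the operator iterated in Rodrigues' formula. *)
Definition dexp Q : {poly R} := Q^`() - Q.

Lemma leq_size_deriv Q : (size Q^`() <= size Q)%N.
Proof.
by have [->|/lt_size_deriv/ltnW//] := eqVneq Q 0; rewrite deriv0.
Qed.

Definition laguerre_poly (k : nat) : {poly R} := k`!%:R^-1 *: iter k dexp 'X^k.

Lemma dexpZ c Q : dexp (c *: Q) = c *: dexp Q.
Proof. by rewrite /dexp derivZ scalerBr. Qed.

Lemma dexpD P Q : dexp (P + Q) = dexp P + dexp Q.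
Proof. by rewrite /dexp derivD; ring. Qed.

Lemma iter_dexpD n P Q : iter n dexp (P + Q) = iter n dexp P + iter n dexp Q.
Proof. by elim: n => //= n ->; rewrite dexpD. Qed.

Lemma iter_dexpZ n c Q : iter n dexp (c *: Q) = c *: iter n dexp Q.
Proof. by elim: n => //= n ->; rewrite dexpZ. Qed.

Lemma dexpM P Q : dexp (P * Q) = P * dexp Q + P^`() * Q.
Proof. by rewrite /dexp derivM; ring. Qed.

(** dexp is a derivation up to a multiple of the identity, and the second
    derivative of 'X vanishes: the Leibniz formula has only two terms. *)
Lemma iter_dexpX n Q :
  iter n dexp ('X * Q) = 'X * iter n dexp Q + n%:R *: iter n.-1 dexp Q.
Proof.
elim: n Q => [|n IH] Q; first by rewrite /= scale0r addr0.
rewrite iterS IH dexpD dexpM dexpZ derivX mul1r.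
case: n {IH} => [|n] /=; first by rewrite scale0r addr0 scale1r.
by rewrite -addrA -(natr1 n.+1) scalerDl scale1r; congr (_ + _); rewrite addrC.
Qed.

(** X^k satisfies X dexp(X^k) = k X^k - X X^k; applying dexp k+1 times and
    commuting it past X gives Laguerre's equation for dexp^k(X^k). *)
Lemma laguerre_ode k : let y := laguerre_poly k in
  'X * y^`()^`() + (1 - 'X) * y^`() + k%:R *: y = 0.
Proof.
move=> y.
have X1 : 'X * dexp 'X^k = k%:R *: 'X^k - 'X * ('X^k : {poly R}).
  rewrite /dexp derivXn mulrBr; congr (_ - _); case: k {y} => [|k].
    by rewrite mulr0n mulr0 scale0r.
  by rewrite /= scaler_nat mulrnAr -exprS.
have := congr1 (iter k.+1 dexp) X1.
rewrite -[- ('X * _)]scaleN1r iter_dexpD !iter_dexpZ !iter_dexpX -!iterSr /=.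
set w := iter k dexp 'X^k => H.
have {}H : 'X * w^`()^`() + (1 - 'X) * w^`() + k%:R *: w = 0.
  move/eqP: H; rewrite -subr_eq0 => /eqP; rewrite /dexp !derivB -!mul_polyC => H.
  rewrite -[RHS]H -(natr1 k) polyCD polyCN polyC1; ring.
rewrite /y /laguerre_poly -/w !derivZ -[RHS](scaler0 _ (k`!%:R^-1)) -H.
rewrite -!mul_polyC; ring.
Qed.

(** The integral of Q(x) e^(-px) over (0,oo), as a linear form on polynomials:
    integration by parts becomes a polynomial identity. *)
Definition exp_moment p Q : R := \sum_(i < size Q) Q`_i * (i`!%:R / p ^+ i.+1).

Lemma exp_moment_wide p n Q : (size Q <= n)%N ->
  exp_moment p Q = \sum_(i < n) Q`_i * (i`!%:R / p ^+ i.+1).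
Proof.
move=> sn; rewrite /exp_moment (big_ord_widen n (fun i => Q`_i * (i`!%:R / p ^+ i.+1)))//.
rewrite big_mkcond/=; apply: eq_bigr => i _; case: ltnP => // h.
by rewrite nth_default// mul0r.
Qed.

Lemma exp_momentD p P Q : exp_moment p (P + Q) = exp_moment p P + exp_moment p Q.
Proof.
have h := leq_trans (size_polyD P Q) (leqnn _).
rewrite (exp_moment_wide _ h) (exp_moment_wide _ (leq_maxl (size P) (size Q))).
rewrite (exp_moment_wide _ (leq_maxr (size P) (size Q))) -big_split/=.
by apply: eq_bigr => i _; rewrite coefD mulrDl.
Qed.

Lemma exp_momentZ p c Q : exp_moment p (c *: Q) = c * exp_moment p Q.
Proof.
rewrite (exp_moment_wide _ (size_scale_leq c Q)) /exp_moment mulr_sumr.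
by apply: eq_bigr => i _; rewrite coefZ mulrA.
Qed.

Lemma exp_momentB p P Q : exp_moment p (P - Q) = exp_moment p P - exp_moment p Q.
Proof. by rewrite exp_momentD -scaleN1r exp_momentZ mulN1r. Qed.

Lemma exp_momentXn p n : exp_moment p 'X^n = n`!%:R / p ^+ n.+1.
Proof.
rewrite /exp_moment size_polyXn big_ord_recr/= big1 => [|i _].
  by rewrite coefXn eqxx mul1r add0r.
by rewrite coefXn ltn_eqF ?mul0r.
Qed.

(** Integration by parts; - Q(0) is the boundary term. *)
Lemma exp_moment_deriv p Q : p != 0 ->
  exp_moment p Q^`() = p * exp_moment p Q - Q.[0].
Proof.
move=> p0; have hs : (size Q <= (size Q).+1)%N by [].
have hd : (size Q^`() <= size Q)%N.
  exact: leq_size_deriv.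
rewrite (exp_moment_wide _ hd) (exp_moment_wide _ hs) horner_coef0.
rewrite mulr_sumr big_ord_recl/= expr1 fact0 div1r mulrCA mulfV// mulr1.
rewrite addrAC subrr add0r; apply: eq_bigr => i _.
rewrite coef_deriv -mulr_natr /= /bump leq0n add1n factS natrM !exprS.
by field; rewrite p0 expf_neq0.
Qed.

Lemma exp_moment_dexp p Q : p != 0 ->
  exp_moment p (dexp Q) = (p - 1) * exp_moment p Q - Q.[0].
Proof. by move=> p0; rewrite exp_momentB exp_moment_deriv//; ring. Qed.

(** dexp lowers the order of vanishing at 0 by at most one, so repeated
    integrations by parts have no boundary terms. *)
Lemma iter_dexp_horner0 j k : (j < k)%N -> (iter j dexp 'X^k).[0 : R] = 0.
Proof.
move=> jk.
suff : forall Q n, exists S, iter n dexp ('X^n * 'X * Q) = 'X * S.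
  move=> /(_ 'X^(k - j.+1) j)[S]; rewrite -exprSr -exprD subnKC// => ->.
  by rewrite hornerM hornerX mul0r.
move=> {j k jk} Q n; elim: n Q => [|n IH] Q; first by exists Q; rewrite /= mul1r.
rewrite iterSr.
have -> : dexp ('X^(n.+1) * 'X * Q) =
   'X^n * 'X * ('X * dexp Q + n.+2%:R *: Q).
  rewrite dexpM -exprSr derivXn /= -mul_polyC polyC_natr -mulr_natr !exprS; ring.
by have [S ->] := IH ('X * dexp Q + n.+2%:R *: Q); exists S.
Qed.

(** The k integrations by parts hidden in Rodrigues' formula contribute a
    factor p - 1 each. *)
Lemma exp_moment_laguerre p k : p != 0 ->
  exp_moment p (laguerre_poly k) = (p - 1) ^+ k / p ^+ k.+1.
Proof.
move=> p0; rewrite exp_momentZ.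
suff H : forall j, (j <= k)%N ->
    exp_moment p (iter j dexp 'X^k) = (p - 1) ^+ j * exp_moment p 'X^k.
  have fn0 : k`!%:R != 0 :> R by rewrite pnatr_eq0 -lt0n fact_gt0.
  by rewrite H// exp_momentXn mulrCA [X in _ * X]mulrA mulVf// mul1r.
elim=> [|j IH] jk; first by rewrite expr0 mul1r.
rewrite iterS exp_moment_dexp// IH ?(ltnW jk)// iter_dexp_horner0// subr0.
by rewrite exprS mulrA.
Qed.

(** Integrations by parts move the derivatives of Rodrigues' formula to P. *)
Lemma exp_moment_iter_dexp j k P : (j <= k)%N ->
  exp_moment 1 (P * iter j dexp 'X^k) = (-1) ^+ j * exp_moment 1 (P^`(j) * 'X^k).
Proof.
elim: j P => [|j IH] P jk; first by rewrite expr0 mul1r.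
have -> : P * iter j.+1 dexp 'X^k =
   dexp (P * iter j dexp 'X^k) - P^`() * iter j dexp 'X^k.
  by rewrite dexpM iterS; ring.
rewrite exp_momentB exp_moment_dexp ?oner_eq0// subrr mul0r hornerM.
rewrite iter_dexp_horner0// mulr0 subr0 sub0r IH ?(ltnW jk)// -derivSn.
by rewrite exprS mulN1r mulNr.
Qed.

Lemma size_iter_dexp n Q : (size (iter n dexp Q) <= size Q)%N.
Proof.
elim: n => //= n IH; rewrite (leq_trans (size_polyD _ _))// size_polyN geq_max IH.
by rewrite andbT (leq_trans (leq_size_deriv _)).
Qed.

Lemma size_laguerre k : (size (laguerre_poly k) <= k.+1)%N.
Proof.
rewrite (leq_trans (size_scale_leq _ _))// (leq_trans (size_iter_dexp _ _))//.
by rewrite size_polyXn.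
Qed.

Lemma iter_dexp_lead n k : (iter n dexp 'X^k)`_k = (-1) ^+ n :> R.
Proof.
elim: n => [|n IH]; first by rewrite /= coefXn eqxx.
rewrite iterS /dexp coefB coef_deriv nth_default ?mul0rn ?sub0r ?IH ?exprS ?mulN1r//.
by rewrite (leq_trans (size_iter_dexp _ _))// size_polyXn.
Qed.

(** The k derivatives moved to a polynomial of degree j < k kill it. *)
Lemma laguerre_ortho_lt j k : (j < k)%N ->
  exp_moment 1 (laguerre_poly j * laguerre_poly k) = 0.
Proof.
move=> jk; rewrite /laguerre_poly -scalerAr exp_momentZ exp_moment_iter_dexp//.
suff -> : (laguerre_poly j)^`(k) = 0.
  by rewrite mul0r /exp_moment size_poly0 big_ord0 !mulr0.
apply/derivn_poly0; exact: leq_trans (size_laguerre _) jk.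
Qed.

Lemma laguerre_ortho j k :
  exp_moment 1 (laguerre_poly j * laguerre_poly k) = (j == k)%:R.
Proof.
have [jk|jk|<-] := ltngtP j k; first exact: laguerre_ortho_lt.
  by rewrite mulrC; exact: laguerre_ortho_lt.
have fn0 : j`!%:R != 0 :> R by rewrite pnatr_eq0 -lt0n fact_gt0.
rewrite {2}/laguerre_poly -scalerAr exp_momentZ exp_moment_iter_dexp//.
have -> : (laguerre_poly j)^`(j) = ((-1) ^+ j)%:P.
  apply/polyP => i; rewrite coef_derivn coefC.
  case: i => [|i]; last first.
    rewrite nth_default ?mul0rn// (leq_trans (size_laguerre _))//.
    by rewrite addnS ltnS leq_addr.
  by rewrite addn0 ffactnn coefZ iter_dexp_lead -[LHS]mulr_natr mulrAC mulVf ?mul1r.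
rewrite mul_polyC exp_momentZ [X in _ * X]mulrA -exprMn mulrNN mulr1 expr1n mul1r.
by rewrite exp_momentXn expr1n divr1 mulVf.
Qed.

(** Laguerre's equation says that (x e^(-x) L_k')' = - k e^(-x) L_k, so one
    integration by parts reduces this to the orthonormality of the L_k. *)
Lemma laguerre_deriv_ortho j k :
  exp_moment 1 ('X * (laguerre_poly j)^`() * (laguerre_poly k)^`())
  = k%:R * (j == k)%:R.
Proof.
set P := laguerre_poly j; set y := laguerre_poly k.
have E : 'X * P^`() * y^`() = dexp (P * ('X * y^`())) + k%:R *: (P * y).
  have := laguerre_ode k; rewrite /= -/y => H.
  have -> : k%:R *: (P * y) = P * (k%:R *: y) by rewrite scalerAr.
  have -> : k%:R *: y = - ('X * y^`()^`() + (1 - 'X) * y^`()).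
    by apply/eqP; rewrite -addr_eq0 addrC H.
  rewrite /dexp !derivM derivX; ring.
rewrite E exp_momentD exp_momentZ laguerre_ortho.
rewrite exp_moment_dexp ?oner_eq0// subrr mul0r sub0r.
by rewrite !hornerM hornerX mul0r mulr0 oppr0 add0r.
Qed.

End LaguerrePoly.

(** * Newton interpolation of power series with bounded coefficients *)

Section PowerSeries.
Context {R : realType}.
Implicit Types (b c : nat -> R) (x y A s theta : R).

Definition bounded_seq_by A b := forall n, `|b n| <= A.

Definition pser b x : R := limn (series (fun n => b n * x ^+ n)).

Lemma pser_cvg A b x : bounded_seq_by A b -> `|x| < 1 ->
  cvgn (series (fun n => b n * x ^+ n)).
Proof.
move=> bA x1; apply: normed_cvg.
apply: (@series_le_cvg _ _ (fun n => A * `|x| ^+ n)) => //.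
- by move=> n /=.
- by move=> n /=; rewrite mulr_ge0 ?exprn_ge0// (le_trans _ (bA n)).
- by move=> n /=; rewrite normrM normrX ler_wpM2r// exprn_ge0.
- by apply: is_cvg_geometric_series; rewrite normr_id.
Qed.

Lemma pser_norm_le A b x s : bounded_seq_by A b -> `|x| <= s -> s < 1 ->
  `|pser b x| <= A / (1 - s).
Proof.
move=> bA xs s1; have x1 : `|x| < 1 by exact: le_lt_trans xs s1.
have s0 : 0 <= s by exact: le_trans xs.
have A0 : 0 <= A by rewrite (le_trans _ (bA 0%N)).
have cn : cvgn [normed series (fun n => b n * x ^+ n)].
  apply: (@series_le_cvg _ _ (fun n => A * `|x| ^+ n)) => //.
  - by move=> n /=.
  - by move=> n /=; rewrite mulr_ge0 ?exprn_ge0// (le_trans _ (bA n)).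
  - by move=> n /=; rewrite normrM normrX ler_wpM2r// exprn_ge0.
  - by apply: is_cvg_geometric_series; rewrite normr_id.
apply: (le_trans (lim_series_norm cn)).
have cg : `|s| < 1 by rewrite ger0_norm.
rewrite -(cvg_lim _ (@cvg_geometric_series _ A s cg))//.
apply: lim_series_le => //; first exact: is_cvg_geometric_series.
move=> n /=; rewrite normrM normrX ler_pM ?exprn_ge0//.
by rewrite lerXn2r ?nnegrE.
Qed.

Lemma pserD A B b c x : bounded_seq_by A b -> bounded_seq_by B c -> `|x| < 1 ->
  pser (fun n => b n + c n) x = pser b x + pser c x.
Proof.
move=> bA cB x1; rewrite /pser -lim_seriesD; [|exact: pser_cvg x1..].
by congr (limn (series _)); apply/funext => n; rewrite mulrDl.
Qed.

Lemma pserZ A b x k : bounded_seq_by A b -> `|x| < 1 ->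
  pser (fun n => k * b n) x = k * pser b x.
Proof.
move=> bA x1; rewrite /pser -[RHS]lim_seriesZ; last exact: pser_cvg x1.
by congr (limn (series _)); apply/funext => n; rewrite -mulrA.
Qed.

Lemma pser_recl A b x : bounded_seq_by A b -> `|x| < 1 ->
  pser b x = b 0%N + x * pser (fun n => b n.+1) x.
Proof.
move=> bA x1; rewrite -(pserZ _ (fun n => bA n.+1) x1).
have cv := pser_cvg bA x1.
have cv' : cvgn (series (fun n => x * b n.+1 * x ^+ n)).
  have := pser_cvg (fun n => bA n.+1) x1 => /(is_cvg_seriesZ (k:=x)).
  by congr (cvgn (series _)); apply/funext => n; rewrite -mulrA.
rewrite /pser; apply: cvg_lim => //; rewrite -cvg_shiftS/=.
have -> : (fun n => series (fun n => b n * x ^+ n) n.+1) =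
    (fun n => b 0%N + series (fun n => x * b n.+1 * x ^+ n) n).
  apply/funext => n; rewrite /series/= big_nat_recl// expr0 mulr1.
  by congr (_ + _); apply: eq_bigr => i _; rewrite exprS; ring.
by apply: cvgD => //; exact: cvg_cst.
Qed.

(** The coefficients of (g(z) - g(x)) / (z - x) for g(z) = sum_n b_n z^n. *)
Definition divdiff b x n : R := pser (fun i => b (n.+1 + i)%N) x.

Lemma divdiff0 b x : divdiff b x 0 = pser (fun n => b n.+1) x.
Proof. by []. Qed.

Lemma divdiff_bounded A b x s : bounded_seq_by A b -> `|x| <= s -> s < 1 ->
  bounded_seq_by (A / (1 - s)) (divdiff b x).
Proof. by move=> bA xs s1 n; apply: pser_norm_le xs s1 => i; exact: bA. Qed.

Lemma divdiff_rec A b x n : bounded_seq_by A b -> `|x| < 1 ->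
  divdiff b x n = b n.+1 + x * divdiff b x n.+1.
Proof.
move=> bA x1; rewrite {1}/divdiff (@pser_recl A (fun i => b (n.+1 + i)%N))//.
rewrite addn0; congr (_ + _ * pser _ _); apply/funext => i.
by rewrite addnS addSn.
Qed.

(** With c_0 = g(x) and c_(n+1) = divdiff b x n one has b_n = c_n - x c_(n+1),
    and the two series recombine. *)
Lemma pser_divdiff A b x y : bounded_seq_by A b -> `|x| < 1 -> `|y| < 1 ->
  pser b y = pser b x + (y - x) * pser (divdiff b x) y.
Proof.
move=> bA x1 y1.
have bd : bounded_seq_by (A / (1 - `|x|)) (divdiff b x).
  exact: divdiff_bounded bA (lexx _) x1.
pose c n := if n is n'.+1 then divdiff b x n' else pser b x.
have bc : bounded_seq_by (A / (1 - `|x|)) c.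
  by case=> [|n] /=; [exact: pser_norm_le bA (lexx _) x1|exact: bd].
have bE n : b n = c n + (- x) * divdiff b x n.
  case: n => [|n] /=; last by rewrite (divdiff_rec _ bA)//; ring.
  by rewrite (pser_recl bA x1) -(divdiff0 b x); ring.
have bxd : bounded_seq_by (`|- x| * (A / (1 - `|x|))) (fun n => (- x) * divdiff b x n).
  by move=> n; rewrite normrM ler_wpM2l.
transitivity (pser (fun n => c n + (- x) * divdiff b x n) y).
  by congr pser; apply/funext.
rewrite (pserD bc bxd y1) (pserZ _ bd y1) (pser_recl bc y1) /=; ring.
Qed.

End PowerSeries.

Section Newton.
Context {R : realType}.
Implicit Types (a b c : nat -> R) (x y A s theta : R).

Lemma omegaS a m : omega a m.+1 = omega a m * ('X - (a m)%:P).
Proof. by rewrite /omega big_ord_recr. Qed.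

Lemma size_omega a m : size (omega a m) = m.+1.
Proof. by rewrite /omega size_prod_XsubC [index_enum _]unlock -enumT size_enum_ord. Qed.

(** Newton's scheme.  Each node replaces the remainder by its divided
    difference, at the price of a factor 1/(1-s) on the bound of its
    coefficients.  The last clause is the same identity of power series read at
    degree k, where the remainder may be cut off after degree k. *)
Lemma newton_remainder a c A s m : s < 1 -> (forall j, `|a j| <= s) ->
  bounded_seq_by A c ->
  exists (P : {poly R}) b, [/\ (size P <= m)%N, bounded_seq_by (A / (1 - s) ^+ m) b,
    forall y, `|y| < 1 -> pser c y = P.[y] + (omega a m).[y] * pser b y &
    forall k, c k = P`_k + (omega a m * \poly_(i < k.+1) b i)`_k].
Proof.
move=> s1 as1 cA; elim: m => [|m [P [b [sP bA bP ck]]]].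
  exists 0, c; split; rewrite ?size_poly0 ?expr0 ?divr1//.
    by move=> y _; rewrite /omega big_ord0 !hornerE.
  by move=> k; rewrite /omega big_ord0 mul1r coef0 add0r coef_poly ltnSn.
have a1 : `|a m| < 1 by exact: le_lt_trans (as1 m) s1.
exists (P + pser b (a m) *: omega a m), (divdiff b (a m)); split.
- rewrite (leq_trans (size_polyD _ _))// geq_max (leq_trans sP)//=.
  by rewrite (leq_trans (size_scale_leq _ _))// size_omega.
- by rewrite exprSr invfM mulrA; exact: divdiff_bounded bA (as1 m) s1.
- move=> y y1; rewrite (bP y y1) (pser_divdiff bA a1 y1) omegaS !hornerE; ring.
- move=> k; rewrite {1}ck coefD coefZ -addrA; congr (_ + _).
  set d := divdiff _ _.
  have bE n : b n = (if n is n'.+1 then d n' else pser b (a m)) - a m * d n.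
    case: n => [|n]; last by rewrite {1}/d (divdiff_rec _ bA a1) /d; ring.
    by rewrite (pser_recl bA a1) /d -(divdiff0 b (a m)); ring.
  (* The last term corrects the cut-off: multiplication by 'X pushes the k-th
     coefficient to degree k+1, which is invisible at degree k. *)
  have E : \poly_(i < k.+1) b i =
      (pser b (a m))%:P + ('X - (a m)%:P) * \poly_(i < k.+1) d i - (d k) *: 'X^(k.+1).
    apply/polyP => i; rewrite !(coefD, coefN, coefZ, mulrBl, coefC, coefCM, coefXn) coefXM.
    rewrite !coef_poly; case: i => [|i] /=; rewrite ?ltnS ?bE.
      by rewrite mulr0; ring.
    rewrite eqSS !add0r; have [ik|ik|->] := ltngtP i k.
    + by rewrite mulr0 subr0.
    + by rewrite !mulr0 !subr0.
    + by rewrite mulr0 mulr1 subr0 subrr.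
  rewrite E omegaS mulrBr mulrDr coefB coefD coefMC -!scalerAr coefZ coefMXn ltnSn mulr0 subr0.
  by rewrite mulrA mulrC.
Qed.

(** In the product of the z - a_j, a term of degree at most k takes the constant
    factor at least m - k times, and there are 2^m terms in all. *)
Lemma omega_coef_sum_le a s m k : 0 <= s <= 1 -> (forall j, `|a j| <= s) ->
  \sum_(j < k.+1) `|(omega a m)`_j| <= s ^+ (m - k) * 2 ^+ m.
Proof.
move=> /andP[s0 s1] as1; elim: m k => [|m IH] k.
  rewrite /omega big_ord0 sub0n !expr0 mulr1 big_ord_recl coef1 normr1 big1 ?addr0//.
  by move=> i _; rewrite coef1 normr0.
have am j : `|- a m * (omega a m)`_j| <= s * `|(omega a m)`_j|.
  by rewrite normrM normrN ler_wpM2r.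
have E j : (omega a m.+1)`_j =
    (if j is j'.+1 then (omega a m)`_j' else 0) + - a m * (omega a m)`_j.
  by rewrite omegaS mulrBr coefB coefMX coefMC; case: j => [|j] /=; ring.
have le1 j : `|(omega a m.+1)`_j| <=
    `|(if j is j'.+1 then (omega a m)`_j' else 0)| + s * `|(omega a m)`_j|.
  by rewrite E (le_trans (ler_normD _ _))// lerD2l.
have /le_trans : \sum_(j < k.+1) `|(omega a m.+1)`_j| <= \sum_(j < k.+1)
    (`|(if j : nat is j'.+1 then (omega a m)`_j' else 0)| + s * `|(omega a m)`_j|).
  by apply: ler_sum => j _; exact: le1.
apply; rewrite big_split/= -mulr_sumr big_ord_recl/= normr0 add0r.
have H2 := ler_wpM2l s0 (IH k).
case: k H2 => [|k] H2.
  rewrite big_ord0 add0r (le_trans H2)// !subn0 mulrA -exprS.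
  by rewrite ler_wpM2l ?exprn_ge0// ler_eXn2l// ltr1n.
apply: (le_trans (lerD (IH k) H2)).
rewrite subSS mulrA -exprS [in X in _ <= X]exprS mulrCA mulr_natl mulr2n lerD2l.
rewrite ler_wpM2r ?exprn_ge0// ler_wiXn2l//; lia.
Qed.

(** The interpolation polynomial of g is the polynomial part of Newton's scheme,
    so the error at degree k is a coefficient of omega times the remainder. *)
Lemma interp_coef_error a c A s m k P : 0 <= s < 1 -> (forall j, `|a j| <= s) ->
  injective a -> bounded_seq_by A c ->
  is_lagrange_interp a (fun j => pser c (a j)) m P ->
  `|c k - P`_k| <= A / (1 - s) ^+ m * (s ^+ (m - k) * 2 ^+ m).
Proof.
move=> /andP[s0 s1] as1 ainj cA Pint.
have [Q [b [sQ bA bQ ->]]] := newton_remainder m s1 as1 cA.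
have -> : P = Q.
  apply: is_lagrange_interp_unique ainj Pint _; split=> // j jm.
  rewrite bQ ?(le_lt_trans (as1 j))// (_ : (omega a m).[a j] = 0) ?mul0r ?addr0//.
  rewrite /omega horner_prod (bigD1 (Ordinal jm))//= hornerXsubC subrr mul0r//.
rewrite addrAC subrr add0r coefM.
apply: (le_trans (ler_norm_sum _ _ _)).
have s01 : 0 <= s <= 1 by rewrite s0 ltW.
have B0 : 0 <= A / (1 - s) ^+ m by rewrite (le_trans _ (bA 0%N)).
apply: le_trans (ler_wpM2l B0 (omega_coef_sum_le m k s01 as1)).
rewrite mulr_sumr; apply: ler_sum => j _.
rewrite normrM mulrC ler_wpM2r// coef_poly; case: ifP => // _.
by rewrite normr0.
Qed.

Lemma interp_coef_error_powR a c A s m k P theta :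
  0 < s < 1 -> (forall j, `|a j| <= s) ->
  injective a -> bounded_seq_by A c ->
  is_lagrange_interp a (fun j => pser c (a j)) m P ->
  0 <= theta -> (k < m)%N -> k%:R <= theta * (m%:R - 1) ->
  `|c k - P`_k| <= A * (2 * s `^ (1 - theta) / (1 - s)) ^+ m.
Proof.
move=> /andP[s0 s1] as1 ainj cA Pint th0 km kth.
have s01 : 0 <= s < 1 by rewrite ltW.
apply: (le_trans (interp_coef_error k s01 as1 ainj cA Pint)).
have A0 : 0 <= A by rewrite (le_trans _ (cA 0%N)).
rewrite !exprMn exprVn -!mulrA ler_wpM2l//.
rewrite [X in _ <= X]mulrA [X in _ <= X]mulrC ler_wpM2l//.
  by rewrite invr_ge0 exprn_ge0// subr_ge0 ltW.
rewrite mulrC ler_wpM2l ?exprn_ge0//.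
rewrite -(powR_mulrn (m - k)) ?(ltW s0)// -(powR_mulrn m) ?powR_ge0// -powRrM.
apply: ger_powR; first by rewrite s0 ltW.
rewrite natrB; last exact: ltnW.
nra.
Qed.

End Newton.

(** * Amplification of noise by Lagrange interpolation *)

Section RootsOfUnity.
Context {C : numClosedFieldType}.

(** X^n - 1 is separable, so it has n distinct roots; they form a cyclic group. *)
Lemma prim_root_exists n : (0 < n)%N -> exists z : C, n.-primitive_root z.
Proof.
move=> n_gt0; have [r Dr] := closed_field_poly_normal ('X^n - 1 : {poly C}).
have {}Dr : 'X^n - 1 = \prod_(z <- r) ('X - z%:P).
  by rewrite {1}Dr (monicP _) ?monicXnsubC// scale1r.
have r_uniq : uniq r.
  by rewrite -separable_prod_XsubC -Dr separable_Xn_sub_1// pnatr_eq0 -lt0n.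
have r_size : size r = n.
  by apply: succn_inj; rewrite -(size_prod_XsubC r id) -Dr size_XnsubC.
have r_roots : all n.-unity_root r.
  by apply/allP => z zr; rewrite /root_of_unity Dr root_prod_XsubC.
have /hasP[z _ pz] := has_prim_root n_gt0 r_roots r_uniq (eq_leq (esym r_size)).
by exists z.
Qed.

(** With w = z^(k-l) the sum is 1 + w + ... + w^(n-1), which vanishes for an
    n-th root of unity w other than 1. *)
Lemma prim_root_orthogonal n (z : C) (k l : 'I_n) : n.-primitive_root z ->
  \sum_(j < n) (z ^+ j) ^+ k * ((z ^+ j) ^+ l)^* = n%:R * (k == l)%:R.
Proof.
move=> pz; have n0 := prim_order_gt0 pz.
have z0 : z != 0.
  apply/eqP => z0; have := prim_expr_order pz.
  by rewrite z0 expr0n gtn_eqF// => /eqP; rewrite eq_sym oner_eq0.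
have nz : `|z| = 1.
  apply/eqP; rewrite -(@pexpr_eq1 _ _ n)//.
  by rewrite -normrX prim_expr_order// normr1.
have zC : z^* = z^-1 by rewrite invC_norm nz expr1n invr1 mul1r.
pose w := z ^+ k / z ^+ l.
have -> : \sum_(j < n) (z ^+ j) ^+ k * ((z ^+ j) ^+ l)^* = \sum_(j < n) w ^+ j.
  apply: eq_bigr => j _; rewrite !rmorphXn/= zC /w exprMn !exprVn.
  by rewrite -!exprM mulnC [(j * l)%N]mulnC.
have [kl|kl] := eqVneq k l.
  rewrite /w kl mulfV ?expf_neq0//; under eq_bigr do rewrite expr1n.
  by rewrite sumr_const card_ord mulr1.
rewrite mulr0; apply/eqP.
have w1 : w - 1 != 0.
  rewrite subr_eq0 /w; apply: contra kl => /eqP e.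
  have : z ^+ k == z ^+ l by rewrite -[z ^+ k](divfK (expf_neq0 l z0)) e mul1r.
  by rewrite (eq_prim_root_expr pz) !modn_small.
rewrite -(mulrI_eq0 _ (mulfI w1)) -subrX1 subr_eq0.
have zn i : (z ^+ i) ^+ n = 1 by rewrite exprAC (prim_expr_order pz) expr1n.
by rewrite /w exprMn exprVn !zn invr1 mulr1.
Qed.

(** The roots of unity replace the mean over the unit circle; below degree n
    this is exact. *)
Lemma parseval_prim_root n (z : C) (P : {poly C}) : n.-primitive_root z ->
  (size P <= n)%N ->
  \sum_(j < n) `|P.[z ^+ j]| ^+ 2 = n%:R * \sum_(k < n) `|P`_k| ^+ 2.
Proof.
move=> pz sP.
have E (j : 'I_n) : `|P.[z ^+ j]| ^+ 2 = \sum_(k < n) \sum_(l < n)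
    (P`_k * (z ^+ j) ^+ k) * (P`_l * (z ^+ j) ^+ l)^*.
  rewrite normCK (horner_coef_wide _ sP) rmorph_sum/= mulr_suml.
  by apply: eq_bigr => k _; rewrite mulr_sumr.
rewrite (eq_bigr _ (fun j _ => E j)).
rewrite exchange_big mulr_sumr; apply: eq_bigr => k _ /=.
rewrite exchange_big/= (bigD1 k)//= [X in _ + X]big1 ?addr0 => [|l lk].
  under eq_bigr do rewrite rmorphM/= mulrACA.
  by rewrite -mulr_sumr prim_root_orthogonal// eqxx mulr1 mulrC normCK.
under eq_bigr do rewrite rmorphM/= mulrACA.
by rewrite -mulr_sumr prim_root_orthogonal// eq_sym (negbTE lk) !mulr0.
Qed.

End RootsOfUnity.

Section DiscBound.
Context {R : realType}.
Implicit Types (P : {poly R}) (z : R[i]).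
Notation toC := (real_complex R).

Lemma normcC (x : R) : Normc.normc (toC x) = `|x|.
Proof. by rewrite /= expr0n/= addr0 sqrtr_sqr. Qed.

Lemma normc_nneg z : 0 <= Normc.normc z.
Proof. by case: z => a b; exact: sqrtr_ge0. Qed.

Lemma normC_normc z : `|z| = toC (Normc.normc z).
Proof. by []. Qed.

Lemma sum_coef_sqr_le P m M : (size P <= m)%N ->
  (forall z, `|z| <= 1 -> Normc.normc (map_poly toC P).[z] <= M) ->
  \sum_(k < m) P`_k ^+ 2 <= M ^+ 2.
Proof.
move=> sP PM; case: m sP => [|m] sP.
  by rewrite big_ord0 sqr_ge0.
have [z pz] := @prim_root_exists R[i] m.+1 isT.
have zn : `|z| = 1.
  apply/eqP; rewrite -(@pexpr_eq1 _ _ m.+1)//.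
  by rewrite -normrX prim_expr_order// normr1.
have sPC : (size (map_poly toC P) <= m.+1)%N by rewrite size_map_poly.
have := parseval_prim_root pz sPC.
have -> : \sum_(k < m.+1) `|(map_poly toC P)`_k| ^+ 2 = toC (\sum_(k < m.+1) P`_k ^+ 2).
  rewrite rmorph_sum/=; apply: eq_bigr => k _.
  by rewrite coef_map normC_normc normcC -rmorphXn/= real_normK// num_real.
have -> : \sum_(j < m.+1) `|(map_poly toC P).[z ^+ j]| ^+ 2 =
    toC (\sum_(j < m.+1) Normc.normc (map_poly toC P).[z ^+ j] ^+ 2).
  by rewrite rmorph_sum/=; apply: eq_bigr => k _; rewrite rmorphXn.
rewrite -(rmorph_nat toC) -rmorphM/= => /complexI E.
rewrite -(ler_pM2l (ltr0Sn R m)) -E mulr_natl -[X in _ *+ X](card_ord m.+1) -sumr_const.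
apply: ler_sum => j _; rewrite lerXn2r ?nnegrE//.
- exact: normc_nneg.
- by rewrite (le_trans _ (PM 0 _))// ?normr0// normc_nneg.
- by apply: PM; rewrite normrX zn expr1n.
Qed.

Lemma normc_horner_le (Q : {poly R[i]}) z : `|z| <= 1 ->
  Normc.normc Q.[z] <= \sum_(k < size Q) Normc.normc Q`_k.
Proof.
move=> z1; rewrite -lecR -normC_normc rmorph_sum/= horner_coef.
apply: (le_trans (ler_norm_sum _ _ _)); apply: ler_sum => k _.
by rewrite normrM normrX -normC_normc ler_piMr// exprn_ile1.
Qed.

(** The supremum is meaningful because a polynomial is bounded on the disc by
    the sum of the moduli of its coefficients. *)
Lemma interp_const_ge (a : nat -> R) m n z : (n < m)%N -> `|z| <= 1 ->
  Normc.normc (lagrange_quot a m n z) <= interp_const a m.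
Proof.
move=> nm z1; rewrite /interp_const.
apply: le_trans (le_bigmax _ _ (Ordinal nm)) => /=.
apply: ub_le_sup; last by exists z.
set Q := map_poly toC (omega a m %/ ('X - (a n)%:P)).
exists ((\sum_(k < size Q) Normc.normc Q`_k) * Normc.normc (((omega a m)^`()%R.[a n])%:C%C)^-1).
move=> _ [y y1 <-]; rewrite /lagrange_quot Normc.normcM ler_wpM2r//.
  exact: normc_nneg.
exact: normc_horner_le.
Qed.

Lemma omega_factor (a : nat -> R) m n : (n < m)%N ->
  omega a m = (omega a m %/ ('X - (a n)%:P)) * ('X - (a n)%:P).
Proof.
move=> nm; rewrite divpK// dvdp_XsubCl /root /omega horner_prod.
by rewrite (bigD1 (Ordinal nm))//= hornerXsubC subrr mul0r.
Qed.

Lemma lagrange_interpE (a nu : nat -> R) m : injective a ->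
  lagrange_interp a nu m =
  \sum_(n < m) (nu n / (omega a m)^`().[a n]) *: (omega a m %/ ('X - (a n)%:P)).
Proof.
move=> ainj; apply: is_lagrange_interp_unique (ainj) (lagrange_interpP _ _ ainj) _.
split.
  apply: (leq_trans (size_sum _ _ _)); apply/bigmax_leqP => i _.
  rewrite (leq_trans (size_scale_leq _ _))// size_divp ?polyXsubC_eq0//.
  by rewrite size_XsubC /omega size_prod_XsubC [index_enum _]unlock -enumT size_enum_ord subn1.
move=> j jm; rewrite horner_sum (bigD1 (Ordinal jm))//= hornerZ.
set q := fun n : nat => omega a m %/ ('X - (a n)%:P).
have qj n : (n < m)%N -> (omega a m)^`() = (q n)^`() * ('X - (a n)%:P) + q n.
  by move=> nm; rewrite {1}(omega_factor a nm) derivM derivXsubC mulr1.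
have dj : (omega a m)^`().[a j] = (q j).[a j].
  by rewrite (qj j jm) hornerD hornerM hornerXsubC subrr mulr0 add0r.
have q0 n : (n < m)%N -> n != j -> (q n).[a j] = 0.
  move=> nm nj; have : (omega a m).[a j] == 0.
    rewrite /omega horner_prod (bigD1 (Ordinal jm))//= hornerXsubC subrr mul0r//.
  rewrite (omega_factor a nm) hornerM hornerXsubC mulf_eq0 subr_eq0 -/(q n).
  by rewrite (inj_eq ainj) [j == n]eq_sym (negbTE nj) orbF => /eqP.
have qjj : (q j).[a j] != 0.
  have -> : q j = \prod_(i < m | i != Ordinal jm) ('X - (a i)%:P).
    rewrite /q /omega (bigD1 (Ordinal jm))//= mulrC mulpK// polyXsubC_eq0//.
  rewrite horner_prod; apply/prodf_neq0 => i ij.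
  rewrite hornerXsubC subr_eq0 (inj_eq ainj) eq_sym.
  by apply: contra ij => /eqP e; apply/eqP/val_inj.
rewrite dj -/(q j) divfK// big1 ?addr0// => i ij.
rewrite hornerZ -/(q i) q0 ?mulr0//.
Qed.

(** By Lagrange's formula the polynomial is a sum of m multiples d_n q_n of the
    Lagrange quotients q_n, which are bounded by D_m on the disc. *)
Lemma interp_noise (a d : nat -> R) e m : injective a ->
  (forall j, `|d j| <= e) ->
  \sum_(k < m) (lagrange_interp a d m)`_k ^+ 2 <= (e * (m%:R * interp_const a m)) ^+ 2.
Proof.
move=> ainj de; apply: sum_coef_sqr_le => [|z z1].
  by have [] := lagrange_interpP d m ainj.
have -> : (map_poly toC (lagrange_interp a d m)).[z] =
    \sum_(n < m) toC (d n) * lagrange_quot a m n z.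
  rewrite lagrange_interpE// rmorph_sum horner_sum; apply: eq_bigr => n _.
  by rewrite /= map_polyZ hornerZ /lagrange_quot rmorphM/= fmorphV mulrAC mulrA.
rewrite -lecR -normC_normc (le_trans (ler_norm_sum _ _ _))//.
under eq_bigr do rewrite normrM.
rewrite mulrCA mulr_natl -[X in _ *+ X](card_ord m) -sumr_const rmorph_sum/=.
apply: ler_sum => n _; rewrite rmorphM/= ler_pM//.
  by rewrite normC_normc normcC lecR.
by rewrite normC_normc lecR interp_const_ge.
Qed.

End DiscBound.

(** * Orthonormal expansions in a weighted L^2 space *)

Section WeightedL2.
Context d (T : measurableType d) (R : realType) (mu : {measure set T -> \bar R}).
Variables (D : set T) (w : T -> R).
Hypotheses (mD : measurable D) (mw : measurable_fun D w)
  (w0 : forall x, D x -> 0 <= w x).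
Implicit Types (F G H h g : T -> R) (c : nat -> R).

Definition wint (h : T -> R) := mu.-integrable D (fun x => (h x * w x)%:E).

Definition wL2 F := measurable_fun D F /\ wint (fun x => F x ^+ 2).

Definition ip F G : R := \int[mu]_(x in D) (F x * G x * w x).

Definition nsq F : R := ip F F.

Lemma wint_le h g : measurable_fun D h -> wint g ->
  (forall x, D x -> `|h x| <= g x) -> wint h.
Proof.
move=> mh ig hg; apply: le_integrable ig => //.
  by apply/measurable_EFinP; exact: measurable_funM.
move=> x Dx /=; rewrite lee_fin !normrM ler_wpM2r//.
by rewrite (le_trans (hg x Dx))// ler_norm.
Qed.

Lemma wintD h g : wint h -> wint g -> wint (fun x => h x + g x).
Proof.
move=> ih ig; have := integrableD mD ih ig; congr (_.-integrable D _).
by apply/funext => x /=; rewrite -EFinD mulrDl.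
Qed.

Lemma wintZ k h : wint h -> wint (fun x => k * h x).
Proof.
move=> ih; have := integrableZl mD k ih; congr (_.-integrable D _).
by apply/funext => x /=; rewrite -EFinM mulrA.
Qed.

Lemma wL2D F G : wL2 F -> wL2 G -> wL2 (fun x => F x + G x).
Proof.
move=> [mF iF] [mG iG]; split; first exact: measurable_funD.
apply: (@wint_le _ (fun x => 2 * F x ^+ 2 + 2 * G x ^+ 2)).
- by apply: measurable_funX; exact: measurable_funD.
- by apply: wintD; exact: wintZ.
- move=> x Dx; rewrite ger0_norm ?sqr_ge0//; have := sqr_ge0 (F x - G x); nra.
Qed.

Lemma wL2Z k F : wL2 F -> wL2 (fun x => k * F x).
Proof.
move=> [mF iF]; split; first exact: measurable_funM.
have := wintZ (k ^+ 2) iF; congr wint; apply/funext => x; ring.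
Qed.

Lemma wL2B F G : wL2 F -> wL2 G -> wL2 (fun x => F x - G x).
Proof.
move=> LF LG; have := wL2D LF (wL2Z (-1) LG); congr wL2.
by apply/funext => x; rewrite mulN1r.
Qed.

Lemma wL2_0 : wL2 (fun=> 0).
Proof.
split; first exact: measurable_cst.
rewrite /wint; under eq_fun do rewrite expr0n/= mul0r.
exact: integrable0.
Qed.

Lemma wL2_sum (I : Type) (r : seq I) (E : I -> T -> R) :
  (forall i, wL2 (E i)) -> wL2 (fun x => \sum_(i <- r) E i x).
Proof.
move=> LE; elim: r => [|i r IH].
  by have := wL2_0; congr wL2; apply/funext => x; rewrite big_nil.
have := wL2D (LE i) IH; congr wL2.
by apply/funext => x; rewrite big_cons.
Qed.

Lemma wL2_le F G : measurable_fun D F -> wL2 G ->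
  (forall x, D x -> `|F x| <= G x) -> wL2 F.
Proof.
move=> mF [mG iG] FG; split => //.
apply: wint_le iG _; first exact: measurable_funX.
move=> x Dx; rewrite ger0_norm ?sqr_ge0// -(real_normK (num_real (F x))).
by rewrite lerXn2r ?nnegrE ?FG// (le_trans _ (FG x Dx)).
Qed.

Lemma wL2_wintM F G : wL2 F -> wL2 G -> wint (fun x => F x * G x).
Proof.
move=> [mF iF] [mG iG].
apply: (@wint_le _ (fun x => F x ^+ 2 + G x ^+ 2)).
- exact: measurable_funM.
- exact: wintD.
- move=> x Dx; rewrite ler_norml; apply/andP; split.
    have := sqr_ge0 (F x + G x); nra.
  have := sqr_ge0 (F x - G x); nra.
Qed.

Lemma ipC F G : ip F G = ip G F.
Proof. by apply: eq_Rintegral => x _; rewrite (mulrC (F x)). Qed.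

Lemma ipDl F G H : wL2 F -> wL2 G -> wL2 H ->
  ip (fun x => F x + G x) H = ip F H + ip G H.
Proof.
move=> LF LG LH; rewrite /ip -RintegralD//; [|exact: wL2_wintM..].
by apply: eq_Rintegral => x _; ring.
Qed.

Lemma ipZl k F H : wL2 F -> wL2 H -> ip (fun x => k * F x) H = k * ip F H.
Proof.
move=> LF LH; rewrite /ip -RintegralZl//; last exact: wL2_wintM.
by apply: eq_Rintegral => x _; ring.
Qed.

Lemma ipBl F G H : wL2 F -> wL2 G -> wL2 H ->
  ip (fun x => F x - G x) H = ip F H - ip G H.
Proof.
move=> LF LG LH; rewrite -[- ip G H]mulN1r -(ipZl _ LG LH) -ipDl//.
  by apply: eq_Rintegral => x _; ring.
exact: wL2Z.
Qed.

Lemma ip_eq F G F' G' : {in D, F =1 F'} -> {in D, G =1 G'} -> ip F G = ip F' G'.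
Proof. by move=> FF GG; apply: eq_Rintegral => x Dx; rewrite FF// GG. Qed.

Lemma nsq_ge0 F : 0 <= nsq F.
Proof.
by apply: Rintegral_ge0 => x Dx; rewrite mulr_ge0 ?w0// -expr2 sqr_ge0.
Qed.

Lemma nsqB F G : wL2 F -> wL2 G ->
  nsq (fun x => F x - G x) = nsq F - 2 * ip F G + nsq G.
Proof.
move=> LF LG; rewrite /nsq ipBl//; last exact: wL2B.
by rewrite !(ipC _ (fun x => F x - G x)) !ipBl// (ipC G F); ring.
Qed.

Lemma nsqD F G : wL2 F -> wL2 G ->
  nsq (fun x => F x + G x) = nsq F + 2 * ip F G + nsq G.
Proof.
move=> LF LG; rewrite /nsq ipDl//; last exact: wL2D.
by rewrite !(ipC _ (fun x => F x + G x)) !ipDl// (ipC G F); ring.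
Qed.

Lemma nsqD_le F G : wL2 F -> wL2 G ->
  nsq (fun x => F x + G x) <= 2 * nsq F + 2 * nsq G.
Proof.
move=> LF LG; have := nsq_ge0 (fun x => F x - G x).
rewrite nsqB// nsqD//; lra.
Qed.

Lemma nsqZ k F : wL2 F -> nsq (fun x => k * F x) = k ^+ 2 * nsq F.
Proof.
move=> LF; rewrite /nsq ipZl//; last exact: wL2Z.
by rewrite ipC ipZl//; ring.
Qed.

Lemma cauchy_schwarz F G : wL2 F -> wL2 G -> ip F G ^+ 2 <= nsq F * nsq G.
Proof.
move=> LF LG.
have H t : 0 <= nsq F - 2 * (t * ip F G) + t ^+ 2 * nsq G.
  have := nsq_ge0 (fun x => F x - t * G x).
  rewrite nsqB//; last exact: wL2Z.
  by rewrite nsqZ// (ipC F) ipZl// (ipC G).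
have [G0|G0] := eqVneq (nsq G) 0.
  have [->|FG0] := eqVneq (ip F G) 0; first by rewrite G0 mulr0 expr0n.
  have := H ((nsq F + 1) / (2 * ip F G)).
  rewrite G0 mulr0 addr0.
  have -> : 2 * ((nsq F + 1) / (2 * ip F G) * ip F G) = nsq F + 1 by field.
  lra.
have Gp : 0 < nsq G by rewrite lt0r G0 nsq_ge0.
have := H (ip F G / nsq G).
have -> : nsq F - 2 * (ip F G / nsq G * ip F G) + (ip F G / nsq G) ^+ 2 * nsq G =
  (nsq F * nsq G - ip F G ^+ 2) / nsq G by field.
by rewrite pmulr_lge0 ?invr_gt0// subr_ge0.
Qed.

Section Orthonormal.
Variable e : nat -> T -> R.
Hypothesis Le : forall k, wL2 (e k).
Hypothesis ortho : forall j k, ip (e j) (e k) = (j == k)%:R.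

Definition lincomb c n : T -> R := fun x => \sum_(k < n) c k * e k x.

Definition fcoef F k := ip F (e k).

Lemma wL2_lincomb c n : wL2 (lincomb c n).
Proof. by apply: (@wL2_sum _ _ (fun k : 'I_n => fun x => c k * e k x)) => i; exact: wL2Z. Qed.

Lemma lincombS c n : lincomb c n.+1 = (fun x => lincomb c n x + c n * e n x).
Proof. by apply/funext => x; rewrite /lincomb big_ord_recr. Qed.

Lemma fcoef_lincomb c n k : fcoef (lincomb c n) k = if (k < n)%N then c k else 0.
Proof.
elim: n => [|n IH].
  rewrite /fcoef /ip; under eq_Rintegral do rewrite /lincomb big_ord0 mul0r mul0r.
  by rewrite /Rintegral integral0.
rewrite lincombS /fcoef ipDl//; [|exact: wL2_lincomb|exact: wL2Z].
rewrite ipZl// ortho -/(fcoef _ _) IH [(k < n.+1)%N]ltnS [(k <= n)%N]leq_eqVlt.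
by have [nk|nk|->] := ltngtP k n; rewrite /= ?ltnn ?mulr0 ?mulr1 ?add0r ?addr0.
Qed.

Lemma nsq_sub_lincomb F c n : wL2 F ->
  nsq (fun x => F x - lincomb c n x) =
  nsq F - \sum_(k < n) fcoef F k ^+ 2 + \sum_(k < n) (fcoef F k - c k) ^+ 2.
Proof.
move=> LF; elim: n => [|n IH].
  rewrite !big_ord0 subr0 addr0; apply: ip_eq => x _;
  by rewrite /lincomb big_ord0 subr0.
rewrite !big_ord_recr/=.
have -> : nsq (fun x => F x - lincomb c n.+1 x) =
   nsq (fun x => (F x - lincomb c n x) - c n * e n x).
  by apply: ip_eq => x _; rewrite lincombS; ring.
have Lc := wL2_lincomb c n.
rewrite nsqB; [|exact: wL2B|exact: wL2Z].
rewrite IH nsqZ// {2}/nsq ortho eqxx ipC ipZl//; last exact: wL2B.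
rewrite ipC ipBl// -/(fcoef _ _) -/(fcoef _ _) fcoef_lincomb ltnn mulr1; ring.
Qed.

Lemma bessel F n : wL2 F -> \sum_(k < n) fcoef F k ^+ 2 <= nsq F.
Proof.
move=> LF; have := nsq_ge0 (fun x => F x - lincomb (fcoef F) n x).
rewrite nsq_sub_lincomb// [X in _ + X]big1 => [|k _]; last by rewrite subrr expr0n.
by rewrite addr0 subr_ge0.
Qed.

(** By Pythagoras, the squared distance from F to the span of the first n
    functions of the orthonormal family. *)
Definition resid F n := nsq F - \sum_(k < n) fcoef F k ^+ 2.

Lemma resid_le F c n : wL2 F -> resid F n <= nsq (fun x => F x - lincomb c n x).
Proof.
by move=> LF; rewrite nsq_sub_lincomb// lerDl sumr_ge0// => k _; rewrite sqr_ge0.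
Qed.

Lemma resid_eq F n : wL2 F -> resid F n = nsq (fun x => F x - lincomb (fcoef F) n x).
Proof.
move=> LF; rewrite nsq_sub_lincomb// [X in _ + X]big1 ?addr0// => k _.
by rewrite subrr expr0n.
Qed.

Lemma resid_decr F n k : (n <= k)%N -> resid F k <= resid F n.
Proof.
move=> nk; rewrite lerD2l lerN2 -(subnKC nk) big_split_ord/= lerDl sumr_ge0//.
by move=> i _; rewrite sqr_ge0.
Qed.

(** Stated through residuals, so that Parseval's identity is immediate. *)
Definition in_closure F := wL2 F /\ forall eps, 0 < eps -> exists n, resid F n < eps.

Lemma in_closureD F G : in_closure F -> in_closure G ->
  in_closure (fun x => F x + G x).
Proof.
move=> [LF cF] [LG cG]; split; first exact: wL2D.
move=> eps eps0; have e4 : 0 < eps / 4 by rewrite divr_gt0.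
have [n Hn] := cF _ e4; have [k Hk] := cG _ e4.
exists (maxn n k); set N := maxn n k.
apply: (le_lt_trans (resid_le (fun i => fcoef F i + fcoef G i) N (wL2D LF LG))).
have -> : nsq (fun x => F x + G x - lincomb (fun i => fcoef F i + fcoef G i) N x) =
  nsq (fun x => (F x - lincomb (fcoef F) N x) + (G x - lincomb (fcoef G) N x)).
  apply: ip_eq => x _; rewrite /lincomb; under eq_bigr do rewrite mulrDl;
  rewrite big_split/=; ring.
apply: (le_lt_trans (nsqD_le _ _)); [exact/wL2B/wL2_lincomb|exact/wL2B/wL2_lincomb|].
rewrite -!resid_eq//.
have := resid_decr F (leq_maxl n k); have := resid_decr G (leq_maxr n k).
rewrite -/N; lra.
Qed.

Lemma in_closureZ k F : in_closure F -> in_closure (fun x => k * F x).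
Proof.
move=> [LF cF]; split; first exact: wL2Z.
have E n : resid (fun x => k * F x) n = k ^+ 2 * resid F n.
  rewrite /resid nsqZ// mulrBr; congr (_ - _); rewrite mulr_sumr.
  by apply: eq_bigr => i _; rewrite /fcoef ipZl// exprMn.
move=> eps eps0.
have [n Hn] := cF (eps / (k ^+ 2 + 1)) (divr_gt0 eps0 (ltr_wpDl (sqr_ge0 k) ltr01)).
exists n; rewrite E; have k1 : 0 < k ^+ 2 + 1 by rewrite ltr_wpDl ?sqr_ge0.
move: Hn; rewrite ltr_pdivlMr// => Hn.
have := sqr_ge0 k; have : 0 <= resid F n by rewrite resid_eq// nsq_ge0.
nra.
Qed.

Lemma in_closure_sum (I : Type) (r : seq I) (E : I -> T -> R) :
  (forall i, in_closure (E i)) -> in_closure (fun x => \sum_(i <- r) E i x).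
Proof.
move=> LE; elim: r => [|i r IH].
  split; first by apply: wL2_sum => i; have [] := LE i.
  move=> eps eps0; exists 0%N; rewrite /resid big_ord0 subr0 /nsq /ip.
  under eq_Rintegral do rewrite big_nil !mul0r.
  by rewrite /Rintegral integral0.
have := in_closureD (LE i) IH; congr in_closure.
by apply/funext => x; rewrite big_cons.
Qed.

Lemma in_closureB F G : in_closure F -> in_closure G ->
  in_closure (fun x => F x - G x).
Proof.
move=> LF LG; have := in_closureD LF (in_closureZ (-1) LG); congr in_closure.
by apply/funext => x; rewrite mulN1r.
Qed.

Lemma in_closure_closed F : wL2 F ->
  (forall eps, 0 < eps -> exists G, in_closure G /\ nsq (fun x => F x - G x) < eps) ->
  in_closure F.
Proof.
move=> LF H; split=> // eps eps0; have e4 : 0 < eps / 4 by rewrite divr_gt0.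
have [G [[LG cG] FG]] := H _ e4; have [n Hn] := cG _ e4; exists n.
apply: (le_lt_trans (resid_le (fcoef G) n LF)).
have -> : nsq (fun x => F x - lincomb (fcoef G) n x) =
  nsq (fun x => (F x - G x) + (G x - lincomb (fcoef G) n x)).
  by apply: ip_eq => x _; ring.
apply: (le_lt_trans (nsqD_le _ _)); [exact: wL2B|exact/wL2B/wL2_lincomb|].
rewrite -resid_eq//; lra.
Qed.

Lemma in_closure_lim F (F_ : nat -> T -> R) : wL2 F ->
  (forall n, in_closure (F_ n)) -> nsq (fun x => F x - F_ n x) @[n --> \oo] --> 0 ->
  in_closure F.
Proof.
move=> LF cF Fc; apply: in_closure_closed => // eps eps0.
have /cvgrPdist_lt/(_ _ eps0)[N _ HN] := Fc.
exists (F_ N); split => //; have := HN N (leqnn N).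
by rewrite /= sub0r normrN ger0_norm// nsq_ge0.
Qed.

End Orthonormal.

Lemma nsq_dominated F (F_ : nat -> T -> R) G :
  (forall n, measurable_fun D (F_ n)) -> measurable_fun D F -> wL2 G ->
  (forall n x, D x -> `|F_ n x| <= G x) -> (forall x, D x -> `|F x| <= G x) ->
  (forall x, D x -> F_ n x @[n --> \oo] --> F x) ->
  nsq (fun x => F x - F_ n x) @[n --> \oo] --> 0.
Proof.
move=> mF_ mF [mG iG] F_G FG F_F.
pose h n x := ((F x - F_ n x) ^+ 2 * w x)%:E.
have mh n : measurable_fun D (h n).
  apply/measurable_EFinP/measurable_funM => //.
  by apply/measurable_funX/measurable_funB.
have h0 x : D x -> h n x @[n --> \oo] --> 0%E.
  move=> Dx; apply: cvg_EFin; first exact: nearW.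
  rewrite -(mul0r (w x)); apply: cvgM; last exact: cvg_cst.
  have -> : 0 = (F x - F x) ^+ 2 :> R by rewrite subrr expr0n.
  apply: cvgM; (apply: cvgB; [exact: cvg_cst|exact: F_F]).
have hG x n : D x -> (`|h n x| <= (4 * G x ^+ 2 * w x)%:E)%E.
  move=> Dx; rewrite /h /= lee_fin ger0_norm; last by rewrite mulr_ge0 ?sqr_ge0 ?w0.
  rewrite ler_wpM2r ?w0//.
  have := F_G n x Dx; have := FG x Dx; rewrite !ler_norml => /andP[? ?] /andP[? ?].
  nra.
have [_ _] := @dominated_convergence _ _ _ mu D mD h (cst 0%E) _ mh
  (measurable_cst _) (aeW _ h0) (wintZ 4 iG) (aeW _ hG).
rewrite integral0 => hc.
have : fine (\int[mu]_(x in D) h n x) @[n --> \oo] --> fine 0%E.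
  exact: fine_cvg hc.
by [].
Qed.

Import HBNNSimple.

(** A nonnegative function is an increasing limit of simple functions, which it
    dominates; simple functions are combinations of indicators. *)
Lemma in_closure_simple (e : nat -> T -> R) (F : T -> R) :
  (forall k, wL2 (e k)) ->
  (forall j k, ip (e j) (e k) = (j == k)%:R) ->
  (forall A, measurable A -> in_closure e (\1_A : T -> R)) ->
  wL2 F -> in_closure e F.
Proof.
move=> Le ortho cA.
suff pos G : wL2 G -> (forall x, 0 <= G x) -> in_closure e G.
  move=> LF; have [mF _] := LF.
  have LaF : wL2 (fun x => `|F x|).
    split; first exact: measurableT_comp.
    case: LF => _; congr wint; apply/funext => x.
    by rewrite real_normK// num_real.
  have Lp : wL2 (fun x => Num.max (F x) 0).
    apply: wL2_le LaF _; first exact: measurable_funrpos.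
    by move=> x _; rewrite ger0_norm ?le_max ?lexx ?orbT// ge_max ler_norm normr_ge0.
  have Ln : wL2 (fun x => Num.max (- F x) 0).
    apply: wL2_le LaF _; first exact: measurable_funrneg.
    by move=> x _; rewrite ger0_norm ?le_max ?lexx ?orbT// ge_max -normrN ler_norm normr_ge0.
  have := in_closureB Le ortho (pos _ Lp _) (pos _ Ln _).
  have -> : (fun x => Num.max (F x) 0 - Num.max (- F x) 0) = F.
    apply/funext => x; have [Fx|Fx] := leP (F x) 0.
      by rewrite max_l ?oppr_ge0// sub0r opprK.
    by rewrite max_r ?subr0// oppr_le0 ltW.
  by apply=> x; rewrite le_max lexx orbT.
move=> LG G0; have [mG iG] := LG.
have mEG : measurable_fun D (EFin \o G) by exact/measurable_EFinP.
pose g := nnsfun_approx mD mEG.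
have G0' : forall x, D x -> (0 <= (EFin \o G) x)%E by move=> x _; rewrite /= lee_fin.
apply: (@in_closure_lim e Le ortho G (fun n => (g n : T -> R)) LG).
  move=> n.
  have -> : (g n : T -> R) = (fun x => \sum_(y <- finmap.enum_fset (fset_set (range (g n))))
      y * \1_((g n : T -> R) @^-1` [set y]) x).
    apply/funext => x; rewrite fimfunE fsbig_finite//=.
  apply: in_closure_sum => // y; apply: in_closureZ => //; apply: cA.
  exact: measurable_sfunP.
apply: (@nsq_dominated _ _ G) => //.
- move=> n; exact: measurable_funTS.
- move=> n x Dx; rewrite ger0_norm//.
  by rewrite -lee_fin /g nnsfun_approxE; exact: le_approx.
- by move=> x Dx; rewrite ger0_norm.
- move=> x Dx; have := cvg_nnsfun_approx mD mEG G0' Dx.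
  by move/fine_cvg.
Qed.

End WeightedL2.

(** * Integrals of polynomials against exponentials *)

Section Transfer.
Context {R : realType}.

Lemma borel_lebesgue (A : set R) : measurable (A : set (measurableTypeR R)) ->
  measurable (A : set (lebesgueType R)).
Proof. exact: sub_caratheodory. Qed.

Lemma measurable_lebesgue_id :
  measurable_fun setT (idfun : lebesgueType R -> measurableTypeR R).
Proof. by move=> _ A mA; rewrite setTI; exact: borel_lebesgue. Qed.

Lemma measurable_lebesgueT (h : R -> R) :
  measurable_fun setT (h : measurableTypeR R -> R) ->
  measurable_fun setT (h : lebesgueType R -> R).
Proof. by move=> mh; apply: (measurableT_comp mh measurable_lebesgue_id). Qed.

Lemma measurable_halfline : measurable (@halfline R).
Proof. by apply: borel_lebesgue; exact: measurable_itv. Qed.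

(** The identity, from the completed sigma-algebra to the Borel one, transports
    the completed measure to the Lebesgue measure. *)
Lemma integral_lebesgue_ge0 (h : R -> R) (E : set R) :
  measurable (E : set (measurableTypeR R)) ->
  measurable_fun setT (h : measurableTypeR R -> R) ->
  (forall x, E x -> 0 <= h x) ->
  (\int[leb R]_(x in (E : set (lebesgueType R))) (h x)%:E =
   \int[lebesgue_measure]_(x in E) (h x)%:E)%E.
Proof.
move=> mE mh h0.
have := @ge0_integral_pushforward _ _ _ _ R _ measurable_lebesgue_id (leb R)
  E (EFin \o h) mE.
move=> <-//.
- by apply: measurable_funTS; exact/measurable_EFinP.
- by move=> x /set_mem Ex; rewrite lee_fin h0.
Qed.

Lemma continuous_lebesgue (h : R -> R) : continuous h ->
  measurable_fun setT (h : lebesgueType R -> R).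
Proof.
by move=> ch; apply: measurable_lebesgueT; exact: continuous_measurable_fun.
Qed.

End Transfer.

Section ExpMoments.
Context {R : realType}.
Implicit Types (p q : R) (Q : {poly R}).

(** Compare e^(px) with one term of its series. *)
Lemma pow_expR_le (n : nat) p (x : R) : 0 < p -> 0 < x ->
  x ^+ n * expR (- (p * x)) <= n.+1`!%:R / p ^+ n.+1 / x.
Proof.
move=> p0 x0; have px0 : 0 < p * x by exact: mulr_gt0.
have h : (p * x) ^+ n.+1 / n.+1`!%:R <= expR (p * x).
  by apply: le_trans (expR_ge1Dxn n (ltW px0)); rewrite lerDr.
have f0 : 0 < n.+1`!%:R :> R by rewrite ltr0n fact_gt0.
rewrite expRN -ler_pdivlMr ?invr_gt0 ?expR_gt0// invrK.
rewrite -ler_pdivrMl; last by rewrite !divr_gt0// exprn_gt0.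
apply: le_trans h; rewrite le_eqVlt; apply/orP; left; apply/eqP.
rewrite exprMn !invfM !invrK [x ^+ n.+1]exprS.
by field; rewrite gt_eqF.
Qed.

Lemma cvg_pow_expR (n : nat) p : 0 < p ->
  x ^+ n * expR (- (p * x)) @[x --> +oo] --> 0.
Proof.
move=> p0; set K := n.+1`!%:R / p ^+ n.+1.
have K0 : 0 <= K by rewrite divr_ge0// exprn_ge0// ltW.
apply: (@squeeze_cvgr _ _ _ _ (fun=> 0) (fun x : R => K / x)).
- near=> x; apply/andP; split; first by rewrite mulr_ge0 ?expR_ge0// exprn_ge0.
  by apply: pow_expR_le.
- exact: cvg_cst.
- rewrite -(mulr0 K); apply: cvgMr; apply/gtr0_cvgV0; last exact: cvg_id.
  exact: nbhs_pinfty_gt.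
Unshelve. all: end_near. Qed.

Lemma cvg_poly_expR Q p : 0 < p ->
  Q.[x] * expR (- (p * x)) @[x --> +oo] --> 0.
Proof.
move=> p0.
have -> : (fun x => Q.[x] * expR (- (p * x))) =
    (fun x => \sum_(i < size Q) Q`_i * x ^+ i * expR (- (p * x))).
  by apply/funext => x; rewrite horner_coef mulr_suml.
rewrite [X in _ --> X](_ : 0 = \sum_(i < size Q) Q`_i * 0); last first.
  by rewrite big1// => i _; rewrite mulr0.
apply: cvg_big => [|i _]; first exact: add_continuous.
have -> : (fun x => Q`_i * x ^+ i * expR (- (p * x))) =
    (fun x => Q`_i * (x ^+ i * expR (- (p * x)))).
  by apply/funext => x; rewrite mulrA.
by apply: cvgMr; exact: cvg_pow_expR.
Qed.

Lemma is_derive_poly_expR Q p (x : R) :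
  is_derive x 1 (fun x => Q.[x] * expR (- (p * x)))
    ((Q^`() - p *: Q).[x] * expR (- (p * x))).
Proof.
have hl : is_derive x 1 (fun x : R => - (p * x)) (- p).
  have -> : (fun x : R => - (p * x)) = (fun x : R => - p *: x).
    by apply/funext => y; rewrite -mulNr.
  by apply: is_derive_eq; rewrite /GRing.scale/= mulr1.
have hE : is_derive x 1 (fun x : R => expR (- (p * x))) (expR (- (p * x)) * - p).
  exact: (@is_derive1_comp _ expR (fun x => - (p * x))).
have := @is_deriveM _ _ (horner Q) (fun x => expR (- (p * x))) x 1 _ _ _ hE.
move=> h; apply: (is_derive_eq (h _ _)).
by rewrite !hornerE /GRing.scale/=; ring.
Qed.

Lemma derive1_poly_expR Q p :
  derive1 (fun x => Q.[x] * expR (- (p * x))) =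
  (fun x => (Q^`() - p *: Q).[x] * expR (- (p * x))).
Proof.
apply/funext => x; rewrite derive1E; apply: derive_val.
exact: is_derive_poly_expR.
Qed.

Lemma continuous_poly_expR Q p : continuous (fun x => Q.[x] * expR (- (p * x))).
Proof.
move=> x; apply/differentiable_continuous/derivable1_diffP.
by case: (is_derive_poly_expR Q p x).
Qed.

(** The polynomial P such that - P(x) e^(-px) is a primitive of x^n e^(-px). *)
Fixpoint pow_exp_primitive p n : {poly R} :=
  if n is k.+1 then p^-1 *: ('X^n + n%:R *: pow_exp_primitive p k) else p^-1%:P.

Lemma pow_exp_primitive_deriv p n : p != 0 ->
  (pow_exp_primitive p n)^`() - p *: pow_exp_primitive p n = - 'X^n.
Proof.
move=> p0; elim: n => [|n IH] /=.
  by rewrite derivC sub0r -mul_polyC -polyCM mulfV.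
have cq : p^-1%:P * p%:P = 1 :> {poly R} by rewrite -polyCM mulVf.
rewrite derivZ derivD derivXn derivZ.
have -> : (pow_exp_primitive p n)^`() = p *: pow_exp_primitive p n - 'X^n.
  by rewrite -IH addrC subrK.
set P := pow_exp_primitive p n; rewrite -!mul_polyC /= -mulr_natl -polyC_natr.
transitivity (- ((p^-1%:P * p%:P) * 'X^(n.+1) : {poly R})); last by rewrite cq mul1r.
by ring.
Qed.

Lemma pow_exp_primitive0 p n : p != 0 ->
  (pow_exp_primitive p n).[0] = n`!%:R / p ^+ n.+1.
Proof.
move=> p0; elim: n => [|n IH] /=.
  by rewrite hornerC fact0 div1r expr1.
rewrite hornerZ hornerD hornerZ hornerXn expr0n/= add0r IH factS natrM.
by rewrite [p ^+ n.+2]exprS invfM; ring.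
Qed.

Lemma integral_pow_expR n p : 0 < p ->
  (\int[leb R]_(x in @halfline R) (x ^+ n * expR (- (p * x)))%:E =
  (n`!%:R / p ^+ n.+1)%:E)%E.
Proof.
move=> p0.
have E : (fun x : R => x ^+ n * expR (- (p * x))) = (fun x => ('X^n).[x] * expR (- (p * x))).
  by apply/funext => x; rewrite hornerXn.
have cE := @continuous_poly_expR 'X^n p; rewrite -E in cE.
rewrite (@integral_lebesgue_ge0 _ (fun x => x ^+ n * expR (- (p * x))) `]0, +oo[%classic).
- rewrite integral_itv_obnd_cbnd; last first.
    by apply/measurable_EFinP/measurable_funTS; exact: continuous_measurable_fun.
  pose F := fun x => - ((pow_exp_primitive p n).[x] * expR (- (p * x))).
  have dF (x : R) : is_derive x 1 F (x ^+ n * expR (- (p * x))).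
    have := is_deriveN (is_derive_poly_expR (pow_exp_primitive p n) p x).
    by rewrite pow_exp_primitive_deriv ?gt_eqF// hornerN hornerXn mulNr opprK.
  have cF : continuous F.
    move=> x; apply/differentiable_continuous/derivable1_diffP.
    by case: (dF x).
  rewrite (@ge0_continuous_FTC2y _ _ F 0 0).
  + rewrite sub0e /F mulr0 oppr0 expR0 mulr1 pow_exp_primitive0 ?gt_eqF//.
    by rewrite -EFinN opprK.
  + by move=> x x0; rewrite mulr_ge0 ?expR_ge0// exprn_ge0.
  + exact: continuous_subspaceT.
  + by rewrite -oppr0; apply: cvgN; exact: cvg_poly_expR.
  + by move=> x _; case: (dF x).
  + by apply: cvg_at_right_filter; exact: cF.
  + by move=> x _; rewrite derive1E; apply: derive_val; exact: dF.
- exact: measurable_itv.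
- exact: continuous_measurable_fun.
- by move=> x /=; rewrite in_itv/= andbT => x0; rewrite mulr_ge0 ?expR_ge0// exprn_ge0// ltW.
Qed.

Lemma integrable_pow_expR n p : 0 < p ->
  (leb R).-integrable (@halfline R) (fun x => (x ^+ n * expR (- (p * x)))%:E).
Proof.
move=> p0; have E : (fun x : R => x ^+ n * expR (- (p * x))) = (fun x => ('X^n).[x] * expR (- (p * x))).
  by apply/funext => x; rewrite hornerXn.
apply/integrableP; split.
  apply/measurable_EFinP/measurable_funTS/continuous_lebesgue.
  by rewrite E; exact: continuous_poly_expR.
under eq_integral => x /set_mem x0.
  rewrite gee0_abs; last first.
    rewrite lee_fin mulr_ge0 ?expR_ge0// exprn_ge0//.
    by move: x0; rewrite /halfline/= in_itv/= andbT => /ltW.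
  over.
by rewrite integral_pow_expR// ltry.
Qed.

Lemma integrable_poly_expR Q p : 0 < p ->
  (leb R).-integrable (@halfline R) (fun x => (Q.[x] * expR (- (p * x)))%:E).
Proof.
move=> p0.
have -> : (fun x : lebesgueType R => (Q.[x] * expR (- (p * x)))%:E) =
   (fun x => \sum_(i <- index_enum 'I_(size Q)) ((Q`_i)%:E * (x ^+ i * expR (- (p * x)))%:E)%E).
  apply/funext => x; rewrite horner_coef mulr_suml -sumEFin.
  by apply: eq_bigr => i _; rewrite -EFinM mulrA.
apply: integrable_sum; first exact: measurable_halfline.
move=> i _; apply: integrableZl; first exact: measurable_halfline.
exact: integrable_pow_expR.
Qed.

Lemma Rintegral_poly_expR Q p : 0 < p ->
  \int[leb R]_(x in @halfline R) (Q.[x] * expR (- (p * x))) = exp_moment p Q.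
Proof.
move=> p0; rewrite /Rintegral.
have -> : (\int[leb R]_(x in @halfline R) (Q.[x] * expR (- (p * x)))%:E =
   \int[leb R]_(x in @halfline R) \sum_(i <- index_enum 'I_(size Q)) ((Q`_i)%:E * (x ^+ i * expR (- (p * x)))%:E))%E.
  apply: eq_integral => x _; rewrite horner_coef mulr_suml -sumEFin.
  by apply: eq_bigr => i _; rewrite -EFinM mulrA.
have mH := @measurable_halfline R.
rewrite integral_sum//; last first.
  by move=> i; apply: integrableZl => //; exact: integrable_pow_expR.
under eq_bigr => i _.
  rewrite integralZl//; last exact: integrable_pow_expR.
  rewrite integral_pow_expR// -EFinM; over.
by rewrite sumEFin.
Qed.

End ExpMoments.

(** * Laguerre expansions and the Laplace transform *)

Section Rho.
Context {R : realType}.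
Implicit Types (p q c : R) (Q P : {poly R}) (f g : R -> R).

Definition rho : lebesgueType R -> R := fun x => expR (- x).

Lemma measurable_rho : measurable_fun (@halfline R) rho.
Proof.
apply: measurable_funTS; apply: (@continuous_lebesgue _ (fun x : R => expR (- x))).
move=> x; apply: (@continuous_comp _ _ _ (fun x : R => - x) expR).
  exact: opp_continuous.
exact: continuous_expR.
Qed.

Lemma rho_ge0 x : (@halfline R) x -> 0 <= rho x.
Proof. by move=> _; exact: expR_ge0. Qed.

Let mH := @measurable_halfline R.
Let mr := measurable_rho.
Let r0 := rho_ge0.

Local Notation rho_L2 := (wL2 (leb R) (@halfline R) rho).
Local Notation rho_ip := (ip (leb R) (@halfline R) rho).
Local Notation rho_nsq := (nsq (leb R) (@halfline R) rho).

Lemma laguerreE (k : nat) : laguerre k = horner (laguerre_poly k) :> (R -> R).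
Proof.
have H n : derive1n n (fun t : R => expR (- t) * t ^+ k) =
    (fun t => (iter n dexp 'X^k).[t] * expR (- (1 * t))).
  elim: n => [|n IH].
    by apply/funext => t; rewrite /= hornerXn mul1r mulrC.
  by rewrite derive1nS IH derive1_poly_expR scale1r.
apply/funext => x; rewrite /laguerre H /laguerre_poly hornerZ mul1r.
set W := _.[x]; transitivity (k`!%:R^-1 * W * (expR x * expR (- x))); first by ring.
by rewrite -expRD subrr expR0 mulr1.
Qed.

Definition lag k : lebesgueType R -> R := horner (laguerre_poly k).

Local Notation lag_coef := (fcoef (leb R) (@halfline R) rho lag).
Local Notation lag_resid := (resid (leb R) (@halfline R) rho lag).
Local Notation rho_span := (in_closure (leb R) (@halfline R) rho lag).

Lemma Phi_invE P : Phi_inv P = lincomb lag (fun k => P`_k) (size P).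
Proof. by apply/funext => x; apply: eq_bigr => k _; rewrite laguerreE. Qed.

Lemma wL2_poly_expR Q q : - 1 / 2 < q -> rho_L2 (fun x => Q.[x] * expR (- (q * x))).
Proof.
move=> q0; split.
  apply: measurable_funTS; apply: continuous_lebesgue.
  exact: continuous_poly_expR.
have p0 : 0 < 2 * q + 1 by lra.
have := integrable_poly_expR (Q ^+ 2) p0; congr (_.-integrable _ _).
apply/funext => x; congr EFin; rewrite /rho exprMn horner_exp -[RHS]mulrA; congr (_ * _).
by rewrite expr2 -!expRD; congr expR; ring.
Qed.

Lemma wL2_poly Q : rho_L2 (horner Q).
Proof.
have h : - 1 / 2 < 0 :> R by lra.
have := wL2_poly_expR Q h; congr rho_L2; apply/funext => x.
by rewrite mul0r oppr0 expR0 mulr1.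
Qed.

Lemma wL2_lag k : rho_L2 (lag k).
Proof. exact: wL2_poly. Qed.

Lemma ip_lag j k : rho_ip (lag j) (lag k) = (j == k)%:R.
Proof.
rewrite -laguerre_ortho -(Rintegral_poly_expR _ ltr01).
by apply: eq_Rintegral => x _; rewrite hornerM mul1r.
Qed.

Definition expfun q : lebesgueType R -> R := fun x => expR (- (q * x)).

Lemma wL2_expfun q : - 1 / 2 < q -> rho_L2 (expfun q).
Proof.
move=> /(wL2_poly_expR 1); congr rho_L2; apply/funext => x.
by rewrite hornerE mul1r.
Qed.

Lemma fcoef_expfun q k : - 1 / 2 < q ->
  lag_coef (expfun q) k = q ^+ k / (q + 1) ^+ k.+1.
Proof.
move=> q0; have q1 : 0 < q + 1 by lra.
have := exp_moment_laguerre k (lt0r_neq0 q1).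
rewrite addrK => <-; rewrite -(Rintegral_poly_expR _ q1).
apply: eq_Rintegral => x _; rewrite /expfun /rho mulrAC -expRD mulrC.
by congr (_ * expR _); ring.
Qed.

Lemma nsq_expfun q : - 1 / 2 < q -> rho_nsq (expfun q) = (2 * q + 1)^-1.
Proof.
move=> q0; have p0 : 0 < 2 * q + 1 by lra.
transitivity (exp_moment (2 * q + 1) 1).
  rewrite -(Rintegral_poly_expR _ p0); apply: eq_Rintegral => x _.
  by rewrite /expfun /rho -!expRD hornerE mul1r; congr expR; ring.
by rewrite -(expr0 'X) exp_momentXn fact0 div1r expr1.
Qed.

(** The squared coefficients form a geometric progression of ratio
    (q/(q+1))^2, whose full sum is the squared norm 1/(2q+1). *)
Lemma resid_expfun q n : - 1 / 2 < q ->
  lag_resid (expfun q) n =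
  (q / (q + 1)) ^+ (2 * n) / (2 * q + 1).
Proof.
move=> q0; have q1 : q + 1 != 0 by lra.
have q2 : 2 * q + 1 != 0 by lra.
rewrite /resid nsq_expfun//.
elim: n => [|n IH]; first by rewrite big_ord0 muln0 expr0 subr0 mul1r.
have A k : (q / (q + 1)) ^+ (2 * k) = (q ^+ k / (q + 1) ^+ k) ^+ 2.
  by rewrite mulnC exprM exprMn exprVn.
rewrite big_ord_recr/= opprD addrA IH fcoef_expfun// !A !exprS.
have h : (q + 1) ^+ n != 0 by rewrite expf_neq0.
by field; rewrite h q1 q2.
Qed.

Lemma ratio_lt1 q : - 1 / 2 < q -> `|q / (q + 1)| < 1.
Proof.
move=> q0; have q1 : 0 < q + 1 by lra.
rewrite normrM normfV (gtr0_norm q1) ltr_pdivrMr// mul1r ltr_norml; lra.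
Qed.

Lemma cvg_resid_expfun q : - 1 / 2 < q ->
  lag_resid (expfun q) n @[n --> \oo] --> 0.
Proof.
move=> q0; under eq_fun do rewrite resid_expfun// exprM.
rewrite -(mul0r (2 * q + 1)^-1); apply: cvgMl; apply: cvg_expr.
by rewrite normrX expr_lt1// ratio_lt1.
Qed.

Lemma closure_expfun q : - 1 / 2 < q ->
  rho_span (expfun q).
Proof.
move=> q0; split; first exact: wL2_expfun.
move=> e e0; have /cvgrPdist_lt/(_ _ e0)[N _ HN] := cvg_resid_expfun q0.
exists N; have := HN N (leqnn N); rewrite /= sub0r normrN.
exact: le_lt_trans (ler_norm _).
Qed.

(** Lf(p) is the scalar product of f with e^(-(p-1)x), which is the limit of its
    Laguerre sums; by Cauchy-Schwarz the limit passes to the scalar product. *)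
Lemma laplace_pser f p : rho_L2 f -> 1 / 2 < p ->
  pser (lag_coef f) (1 - p^-1) = p * laplace f p.
Proof.
move=> Lf p2; set a := lag_coef f.
have q0 : - 1 / 2 < p - 1 by lra.
have p0 : p != 0 by lra.
have Le := wL2_expfun q0.
pose c k := lag_coef (expfun (p - 1)) k.
have cE k : c k = p^-1 * (1 - p^-1) ^+ k.
  rewrite /c fcoef_expfun// subrK exprS invfM.
  have -> : 1 - p^-1 = (p - 1) / p by field.
  rewrite exprMn exprVn; ring.
have lE : laplace f p = rho_ip (expfun (p - 1)) f.
  apply: eq_Rintegral => x _; rewrite /expfun /rho mulrAC -expRD.
  by congr (expR _ * _); ring.
have lincombE n : rho_ip (lincomb lag c n) f = \sum_(k < n) c k * a k.
  elim: n => [|n IH].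
    rewrite big_ord0 /ip; under eq_Rintegral do rewrite /lincomb big_ord0 !mul0r.
    by rewrite /Rintegral integral0.
  rewrite lincombS (ipDl mH mr (wL2_lincomb mH mr wL2_lag c n)
    (wL2Z mH (c n) (wL2_lag n)) Lf).
  by rewrite IH big_ord_recr/= (ipZl mH mr _ (wL2_lag n) Lf) ipC.
have lim : (\sum_(k < n) c k * a k) @[n --> \oo] --> laplace f p.
  apply/cvgrPdist_lt => e e0.
  have e2 : 0 < e ^+ 2 / (rho_nsq f + 1).
    by rewrite divr_gt0 ?exprn_gt0// ltr_wpDl// nsq_ge0.
  have /cvgrPdist_lt/(_ _ e2) := cvg_resid_expfun q0.
  apply: filterS => n; rewrite sub0r normrN => Hn.
  have Lc := wL2_lincomb mH mr wL2_lag c n.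
  rewrite lE -lincombE -(ipBl mH mr Le Lc Lf).
  rewrite -(@ltr_pXn2r _ 2)// ?nnegrE ?ltW// real_normK ?num_real//.
  apply: (le_lt_trans (cauchy_schwarz mH mr r0 (wL2B mH mr Le Lc) Lf)).
  rewrite -(resid_eq mH mr wL2_lag ip_lag)//.
  have := le_lt_trans (ler_norm _) Hn.
  have f0 := nsq_ge0 (leb R) r0 f.
  rewrite ltr_pdivlMr ?ltr_wpDl// => H.
  apply: le_lt_trans H; rewrite ler_wpM2l ?lerDl//.
  rewrite (resid_eq mH mr wL2_lag ip_lag)//; exact: nsq_ge0.
rewrite /pser; apply: cvg_lim => //.
have -> : series (fun n => a n * (1 - p^-1) ^+ n) =
   (fun n => p * \sum_(k < n) c k * a k).
  apply/funext => n; rewrite /series/= big_mkord mulr_sumr; apply: eq_bigr => k _.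
  by rewrite cE; field.
exact: cvgMr.
Qed.

End Rho.

(** * Completeness of the Laguerre polynomials *)

Section StepLimit.
Context {R : realType}.

Lemma bernoulli_ineq (t : R) K : 0 <= t <= 1 -> 1 - K%:R * t <= (1 - t) ^+ K.
Proof.
move=> /andP[t0 t1]; elim: K => [|K IH]; first by rewrite mul0r subr0.
rewrite exprS -natr1; have := ler_wpM2l (_ : 0 <= 1 - t) IH.
rewrite subr_ge0 => /(_ t1); apply: le_trans.
have : 0 <= K%:R * t ^+ 2 :> R by rewrite mulr_ge0// sqr_ge0.
nra.
Qed.

Lemma cvg_natr_expR (b : R) : 0 < b -> n%:R * expR (- (b * n%:R)) @[n --> \oo] --> 0.
Proof.
move=> b0; have := cvg_pow_expR 1 b0 => /(cvg_comp _ _ (@cvgr_idn R)).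
by [].
Qed.

(** Below 1/2, Bernoulli's inequality applies since n 2^n u^n tends to 0; from 1/2
    on, (1 - u^n)^(n 2^n) <= exp(- n (2u)^n).  The factor n in the exponent makes the
    limit 0 at u = 1/2 too, so that an indicator is reached at every point. *)
Lemma cvg_step (u : R) : 0 < u < 1 ->
  (1 - u ^+ n) ^+ (n * 2 ^ n) @[n --> \oo] --> ((u < 1 / 2)%R%:R : R).
Proof.
move=> /andP[u0 u1].
have un n : 0 <= u ^+ n <= 1 by rewrite exprn_ge0 ?exprn_ile1// ltW.
have [u2|u2] := ltP u (1 / 2).
  pose b := - ln (2 * u).
  have b0 : 0 < b by rewrite oppr_gt0 ln_lt0//; lra.
  have H : 1 - n%:R * expR (- (b * n%:R)) @[n --> \oo] --> (1 : R).
    rewrite -[X in _ --> X](subr0 1); apply: cvgB; first exact: cvg_cst.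
    exact: cvg_natr_expR.
  rewrite (_ : true%:R = 1 :> R)//; apply: (squeeze_cvgr _ H); last exact: cvg_cst.
  near=> n; apply/andP; split; last first.
    rewrite exprn_ile1// ?subr_ge0 ?lerBlDr ?lerDl; by case/andP: (un n).
  apply: le_trans (bernoulli_ineq _ (un n)).
  rewrite lerD2l lerN2 natrM natrX -mulrA ler_wpM2l// -exprMn.
  rewrite /b mulNr opprK expRM_natr lnK//.
  by rewrite posrE mulr_gt0.
have H : expR (- n%:R) @[n --> \oo] --> (0 : R) by exact: cvgn_expR.
rewrite (_ : false%:R = 0 :> R)//; apply: (squeeze_cvgr _ _ H); last exact: cvg_cst.
near=> n; have /andP[un0 un1] := un n; apply/andP; split.
  by rewrite exprn_ge0// subr_ge0.
have : 1 - u ^+ n <= expR (- u ^+ n) by exact: expR_ge1Dx.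
move/(lerXn2r (n * 2 ^ n)); rewrite !nnegrE subr_ge0 expR_ge0 => /(_ un1 isT).
move=> /le_trans; apply; rewrite -expRM_natr ler_expR mulNr lerN2.
rewrite natrM natrX mulrCA -exprMn ler_peMr// exprn_ege1//; lra.
Unshelve. all: end_near. Qed.

End StepLimit.

Section Complete.
Context {R : realType}.
Implicit Types (p q c : R) (Q P : {poly R}) (f g : R -> R).
Let mH := @measurable_halfline R.
Let mr := @measurable_rho R.
Let r0 := @rho_ge0 R.

Local Notation rho_L2 := (wL2 (leb R) (@halfline R) rho).
Local Notation rho_nsq := (nsq (leb R) (@halfline R) rho).
Local Notation rho_span := (in_closure (leb R) (@halfline R) rho lag).

Lemma wL2_1 : rho_L2 (fun=> 1).
Proof. by have := wL2_poly (1 : {poly R}); congr rho_L2; apply/funext => x; rewrite hornerE. Qed.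

Lemma wL2_indic (A : set (lebesgueType R)) : measurable A -> rho_L2 (\1_A).
Proof.
move=> mA; apply: (wL2_le mH mr _ wL2_1).
  exact: measurable_indic.
by move=> x _; rewrite indicE ger0_norm// lern1 leq_b1.
Qed.

(** The additional exponential carries the induction: one more factor
    1 - e^(-bx) is the difference of the cases q and q + b. *)
Lemma closure_one_minus_exp b K q : 0 <= b -> 0 <= q ->
  rho_span (fun x => (1 - expR (- (b * x))) ^+ K * expR (- (q * x))).
Proof.
move=> b0; elim: K q => [|K IH] q q0.
  have h : - 1 / 2 < q by lra.
  have := closure_expfun h; congr rho_span; apply/funext => x.
  by rewrite expr0 mul1r.
have := in_closureB mH mr r0 (@wL2_lag R) (@ip_lag R) (IH q q0) (IH (q + b) (addr_ge0 q0 b0)).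
congr rho_span; apply/funext => x; rewrite exprS.
have -> : expR (- ((q + b) * x)) = expR (- (q * x)) * expR (- (b * x)).
  by rewrite -expRD; congr expR; ring.
by ring.
Qed.

Lemma closure_ray c : rho_span (\1_(`]c, +oo[%classic : set R) : lebesgueType R -> R).
Proof.
have mA : measurable (`]c, +oo[%classic : set (lebesgueType R)).
  by apply: borel_lebesgue; exact: measurable_itv.
have [c0|c0] := leP c 0.
  apply: (in_closure_closed mH mr r0 (@wL2_lag R) (@ip_lag R)); first exact: wL2_indic.
  move=> e e0; exists (expfun 0); split; first by apply: closure_expfun; lra.
  rewrite /nsq /ip (@eq_Rintegral _ _ _ _ _ (fun=> 0)).
    by rewrite /Rintegral integral0.
  move=> x /set_mem; rewrite /halfline/= in_itv/= andbT => x0.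
  rewrite indicE mem_set/=; last by rewrite in_itv/= andbT (le_lt_trans c0).
  by rewrite /expfun mul0r oppr0 expR0 subrr !mul0r.
(* e^(-ax) crosses the threshold 1/2 of cvg_step at x = c. *)
pose a := ln 2 / c.
have a0 : 0 < a by rewrite divr_gt0// ln_gt0// ltr1n.
apply: (@in_closure_lim _ _ _ _ _ _ mH mr r0 lag (@wL2_lag R) (@ip_lag R) _
  (fun n x => (1 - expR (- (a * x)) ^+ n) ^+ (n * 2 ^ n))).
- exact: wL2_indic.
- move=> n.
  have := @closure_one_minus_exp (n%:R * a) (n * 2 ^ n) 0 (mulr_ge0 (ler0n _ _) (ltW a0)) (lexx 0).
  congr rho_span; apply/funext => x.
  rewrite mul0r oppr0 expR0 mulr1; congr ((1 - _) ^+ _).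
  by rewrite -expRM_natr; congr expR; ring.
have E x : (@halfline R) x -> 0 < expR (- (a * x)) < 1.
  rewrite /halfline/= in_itv/= andbT => x0.
  by rewrite expR_gt0 expR_lt1 oppr_lt0 mulr_gt0.
apply: (@nsq_dominated _ _ _ _ _ _ mH mr r0 _ _ (fun=> 1)).
- move=> n; apply: measurable_funTS; apply: continuous_lebesgue.
  have ce : continuous (fun x : R => expR (- (a * x))).
    move=> y; have := @continuous_poly_expR R 1 a y; rewrite /continuous_at hornerE mul1r; by under eq_fun do rewrite hornerE mul1r.
  move=> x; apply: (@continuous_comp _ _ _ (fun x : R => 1 - expR (- (a * x)) ^+ n)
     (fun y => y ^+ (n * 2 ^ n))); last exact: exprn_continuous.
  apply: cvgB; first exact: cvg_cst.
  by apply: (@continuous_comp _ _ _ (fun x : R => expR (- (a * x))) (fun y => y ^+ n));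
    [exact: ce|exact: exprn_continuous].
- exact: measurable_indic.
- exact: wL2_1.
- move=> n x /E/andP[/ltW u0 /ltW u1].
  have v0 : 0 <= 1 - expR (- (a * x)) ^+ n by rewrite subr_ge0 exprn_ile1.
  rewrite ger0_norm ?(exprn_ge0 _ v0)// exprn_ile1//.
- by move=> x _; rewrite indicE ger0_norm// lern1 leq_b1.
- move=> x Hx.
  suff -> : \1_(`]c, +oo[%classic : set R) x = (expR (- (a * x)) < 1 / 2)%R%:R :> R.
    exact: cvg_step (E x Hx).
  rewrite indicE mem_setE in_itv/= andbT; congr (_%:R); congr nat_of_bool.
  rewrite div1r -(@lnK R 2) ?posrE// -expRN ltr_expR ltrN2.
  by rewrite /a mulrAC ltr_pdivlMr// ltr_pM2l// ln_gt0// ltr1n.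
Qed.

(** Partial sums of the indicators are dominated by 1. *)
Lemma closure_bigcup (F : (set (lebesgueType R))^nat) :
  (forall n, measurable (F n)) -> trivIset setT F ->
  (forall n, rho_span (\1_(F n))) -> rho_span (\1_(\bigcup_n F n)).
Proof.
move=> mF tF cF.
have mU : measurable (\bigcup_n F n) by exact: bigcup_measurable.
have nn n x : (0 <= (\1_(F n) x)%:E :> \bar R)%E by rewrite lee_fin indicE.
have lesum n x : \sum_(i <- index_iota 0 n) \1_(F i) x <= 1 :> R.
  rewrite -lee_fin -sumEFin.
  apply: (@le_trans _ _ (\1_(\bigcup_n F n) x)%:E); last by rewrite lee_fin indicE lern1 leq_b1.
  rewrite indic_bigcup//; apply: nneseries_lim_ge => k _ _; exact: nn.
apply: (@in_closure_lim _ _ _ _ _ _ mH mr r0 lag (@wL2_lag R) (@ip_lag R) _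
  (fun n x => \sum_(i <- index_iota 0 n) \1_(F i) x)).
- exact: wL2_indic.
- move=> n; apply: (in_closure_sum mH mr r0 (@wL2_lag R) (@ip_lag R)) => i; exact: cF.
apply: (@nsq_dominated _ _ _ _ _ _ mH mr r0 _ _ (fun=> 1)).
- move=> n; apply: measurable_sum => i; exact: measurable_indic.
- exact: measurable_indic.
- exact: wL2_1.
- by move=> n x _; rewrite ger0_norm ?lesum// sumr_ge0// => i _; rewrite indicE.
- by move=> x _; rewrite indicE ger0_norm// lern1 leq_b1.
- move=> x _.
  suff : fine (\sum_(0 <= i < n) (\1_(F i) x : R)%:E)%E @[n --> \oo] -->
      (\1_(\bigcup_n F n) x : R).
    by under eq_fun do rewrite sumEFin.
  apply: fine_cvg; rewrite indic_bigcup//.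
  apply: is_cvg_nneseries => k _ _; exact: nn.
Qed.

(** Half-lines form a pi-system generating the Borel sets, and the sets whose
    indicator lies in the closed span form a lambda-system. *)
Lemma closure_borel (A : set R) : measurable (A : set (measurableTypeR R)) ->
  rho_span (\1_A : lebesgueType R -> R).
Proof.
move=> mA.
pose G := [set A | exists x : R, A = `]x, +oo[%classic].
apply: (@dynkin_induction _ (measurableTypeR R) G (fun A => rho_span (\1_A : lebesgueType R -> R))).
- exact: RGenOInfty.measurableE.
- move=> _ _ [x ->] [y ->]; exists (Num.max x y); apply/seteqP; split => z /=;
  rewrite !in_itv/= !andbT gt_max; first by move=> [-> ->].
  by move=> /andP[].
- rewrite indicT; have h : - 1 / 2 < 0 :> R by lra.
  have := closure_expfun h; congr rho_span.
  by apply/funext => x; rewrite /expfun mul0r oppr0 expR0.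
- by move=> _ [x ->]; exact: closure_ray.
- move=> S mS cS.
  have h : - 1 / 2 < 0 :> R by lra.
  have := in_closureB mH mr r0 (@wL2_lag R) (@ip_lag R) (closure_expfun h) cS.
  congr rho_span; apply/funext => x.
  rewrite /expfun mul0r oppr0 expR0 indicC indicE.
  by case: (x \in S); rewrite /= ?subrr ?subr0.
- move=> F mF tF cF; apply: closure_bigcup => // n.
  exact: borel_lebesgue.
- have := @RGenOInfty.measurableE R => /(congr1 (fun M => M A)) /= E.
  by rewrite -[X in X A]/((@RGenOInfty.G R).-sigma.-measurable) -E.
Qed.

(** A set of the completed sigma-algebra is a Borel set up to a null set. *)
Lemma closure_indic (A : set (lebesgueType R)) : measurable A ->
  rho_span (\1_A).
Proof.
move=> mA; have : (completed_algebra_gen (@lebesgue_measure R)) A.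
  by rewrite -g_sigma_completed_algebra_genE completed_caratheodory_measurable.
move=> [B mB [N [M [mM M0 NM]] BN]].
have mB' : measurable (B : set (lebesgueType R)) by exact: borel_lebesgue.
have mM' : measurable (M : set (lebesgueType R)) by exact: borel_lebesgue.
apply: (in_closure_closed mH mr r0 (@wL2_lag R) (@ip_lag R)); first exact: wL2_indic.
move=> e e0; exists (\1_B); split; first exact: closure_borel.
suff -> : rho_nsq (fun x => \1_A x - \1_B x) = 0 by [].
rewrite /nsq /ip.
have LAB : rho_L2 (fun x => \1_A x - \1_B x).
  by apply: wL2B => //; exact: wL2_indic.
have [mAB iAB] := LAB.
have mABw : measurable_fun (@halfline R)
    (fun x => ((\1_A x - \1_B x) * (\1_A x - \1_B x) * rho x)%:E).
  apply/measurable_EFinP; apply: measurable_funM; last exact: mr.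
  exact: (measurable_funM mAB mAB).
rewrite /Rintegral (@ae_eq_integral _ _ _ (leb R) _ (cst 0%E) _ mH mABw (measurable_cst _)).
  by rewrite integral0.
exists M; split => // x /= /not_implyP[_ H]; apply: contrapT => Mx; apply: H.
have -> : \1_A x = \1_B x :> R; last by rewrite subrr !mul0r.
rewrite !indicE; congr (_%:R); congr nat_of_bool; apply/idP/idP => /set_mem h; apply/mem_set.
  by move: h; rewrite -BN => -[//|/NM].
by rewrite -BN; left.
Qed.

Theorem laguerre_complete f : rho_L2 f -> rho_span f.
Proof.
move=> Lf; apply: (in_closure_simple mH mr r0 (@wL2_lag R) (@ip_lag R) _ Lf).
exact: closure_indic.
Qed.

End Complete.

(** * Smooth cut-off functions on the half-line *)

Section Smooth.
Context {R : realType}.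
Implicit Types (f g : R -> R) (Q : {poly R}).

(** Recursion on the innermost derivative, so that sum and product rules are
    proved by induction on n. *)
Fixpoint n_derivable n f : Prop :=
  (forall x, derivable f x 1) /\
  (if n is k.+1 then n_derivable k (derive1 f) else True).

Lemma n_derivable0 n f : n_derivable n f -> forall x, derivable f x 1.
Proof. by case: n => [|n] []. Qed.

Lemma n_derivableW n f : n_derivable n.+1 f -> n_derivable n f.
Proof.
elim: n f => [|n IH] f [df H]; first by split.
by split => //; exact: IH.
Qed.

Lemma n_derivable_derive1n f : (forall n, n_derivable n f) ->
  forall n x, derivable (derive1n n f) x 1.
Proof.
move=> H n; have := H n; elim: n f {H} => [|n IH] f; first by case.
by move=> [df H] x; rewrite derive1Sn; exact: IH.
Qed.

Lemma n_derivableD n f g : n_derivable n f -> n_derivable n g ->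
  n_derivable n (fun x => f x + g x).
Proof.
elim: n f g => [|n IH] f g [df Hf] [dg Hg].
  by split => [x|//]; exact: derivableD.
split=> [x|]; first exact: derivableD.
have -> : derive1 (fun x => f x + g x) = (fun x => derive1 f x + derive1 g x).
  by apply/funext => x; rewrite !derive1E deriveD.
exact: IH.
Qed.

Lemma derive1M f g : (forall x, derivable f x 1) -> (forall x, derivable g x 1) ->
  derive1 (fun x => f x * g x) = (fun x => derive1 f x * g x + f x * derive1 g x).
Proof.
move=> df dg; apply/funext => x; rewrite !derive1E deriveM//.
by rewrite /GRing.scale/=; ring.
Qed.

Lemma n_derivableM n f g : n_derivable n f -> n_derivable n g ->
  n_derivable n (fun x => f x * g x).
Proof.
elim: n f g => [|n IH] f g Hf Hg; have df := n_derivable0 Hf; have dg := n_derivable0 Hg.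
  by split => [x|//]; exact: derivableM.
split=> [x|]; first exact: derivableM.
rewrite derive1M//; apply: n_derivableD; apply: IH.
- by case: Hf.
- exact: n_derivableW.
- exact: n_derivableW.
- by case: Hg.
Qed.

Lemma n_derivable_poly_expR n Q p : n_derivable n (fun x => Q.[x] * expR (- (p * x))).
Proof.
have d Q' x : derivable (fun x => Q'.[x] * expR (- (p * x))) x 1.
  by case: (is_derive_poly_expR Q' p x).
elim: n Q => [|n IH] Q; first by split.
by split => //; rewrite derive1_poly_expR; exact: IH.
Qed.

(** The functions e^(-1/y) Q(1/y), extended by 0 to y <= 0; this family is stable
    under differentiation. *)
Definition flat Q (y : R) : R := if 0 < y then Q.[y^-1] * expR (- y^-1) else 0.

(** e^(1/y) dominates any power of 1/y; a quadratic bound makes the derivative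
    at 0 vanish. *)
Lemma flat_le_sqr Q : exists2 C, 0 <= C & forall y, `|flat Q y| <= C * y ^+ 2.
Proof.
exists (\sum_(i < size Q) `|Q`_i| * i.+2`!%:R).
  by apply: sumr_ge0 => i _; rewrite mulr_ge0.
move=> y; rewrite /flat; case: ifPn => y0; last first.
  by rewrite normr0 mulr_ge0 ?sqr_ge0// sumr_ge0// => i _; rewrite mulr_ge0.
rewrite horner_coef mulr_suml mulr_suml (le_trans (ler_norm_sum _ _ _))//.
apply: ler_sum => i _; rewrite !normrM -!mulrA ler_wpM2l//.
rewrite normrX !ger0_norm ?expR_ge0 ?invr_ge0 ?(ltW y0)//.
have yi : 0 < y^-1 by rewrite invr_gt0.
have := pow_expR_le i.+1 ltr01 yi.
rewrite expr1n divr1 mul1r invrK exprS -mulrA.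
by rewrite -ler_pdivlMl// invrK mulrCA expr2.
Qed.

Lemma is_derive_sqr_bound f C : (forall y, `|f y| <= C * y ^+ 2) -> is_derive (0 : R) 1 f 0.
Proof.
move=> fC; have f0 : f 0 = 0.
  by apply/eqP; rewrite -normr_le0 (le_trans (fC 0))// expr0n mulr0.
have C0 : 0 <= C by have := fC 1; rewrite expr1n mulr1; apply: le_trans.
have H : (fun h => h^-1 *: ((f \o shift 0) (h *: 1) - f 0)) @ 0^' --> 0.
  apply/cvgrPdist_lt => e e0; near=> h.
  rewrite sub0r normrN /= f0 subr0 addr0 /GRing.scale/= mulr1 normrM normfV.
  have h0 : h != 0 by near: h; exact: nbhs_dnbhs_neq.
  have hp : 0 < `|h| by rewrite normr_gt0.
  rewrite mulrC ltr_pdivrMr// (le_lt_trans (fC h))//.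
  rewrite -(real_normK (num_real h)) expr2 mulrA ltr_pM2r//.
  have : `|h| < e / (C + 1).
    near: h; apply: dnbhs0_lt; rewrite divr_gt0// ltr_wpDl//.
  rewrite ltr_pdivlMr ?ltr_wpDl//; apply: le_lt_trans.
  by rewrite mulrDr mulr1 mulrC lerDl.
split; first by apply/cvg_ex; exists 0.
exact: cvg_lim.
Unshelve. all: end_near. Qed.

Lemma is_derive_flat Q (y : R) : is_derive y 1 (flat Q) (flat ('X^2 * (Q - Q^`())) y).
Proof.
have [y0|y0|<-] := ltgtP 0 y.
- have E : {near y, (fun y => Q.[y^-1] * expR (- (1 * y^-1))) =1 flat Q}.
    near=> z; rewrite /flat mul1r ifT//; near: z; exact: lt_nbhsr.
  apply: (near_eq_is_derive E).
  have hi : is_derive y 1 (fun y : R => y^-1) (- y ^- 2).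
    have y0n : (@idfun R) y != 0 by rewrite gt_eqF.
    have := is_deriveV y0n (is_derive_id y 1); by rewrite /GRing.scale/= mulr1.
  have := is_derive1_comp (is_derive_poly_expR Q 1 y^-1) hi.
  move=> h; apply: (is_derive_eq h).
  by rewrite /flat y0 !hornerE -exprVn ?mul1r; ring.
- have E : {near y, (fun=> 0) =1 flat Q}.
    near=> z; rewrite /flat ifF//; apply/negbTE; rewrite -leNgt ltW//.
    near: z; exact: lt_nbhsl.
  apply: (near_eq_is_derive E).
  rewrite /flat ltNge (ltW y0)/=; exact: is_derive_cst.
- have [C _ fC] := flat_le_sqr Q.
  have -> : flat ('X^2 * (Q - Q^`())) 0 = 0 by rewrite /flat ltxx.
  exact: is_derive_sqr_bound fC.
Unshelve. all: end_near. Qed.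

Lemma is_derive_flat_affine Q (a b x : R) :
  is_derive x 1 (fun x => flat Q (a * x + b)) (a * flat ('X^2 * (Q - Q^`())) (a * x + b)).
Proof.
have hl : is_derive x 1 (fun x : R => a * x + b) a.
  have -> : (fun x : R => a * x + b) = (a *: (@idfun R) + cst b) by apply/funext.
  by apply: is_derive_eq; rewrite addr0 /GRing.scale/= mulr1.
have := @is_derive1_comp R (flat Q) (fun x : R => a * x + b) x _ _ (is_derive_flat Q (a * x + b)) hl.
by move=> h; apply: (is_derive_eq h); rewrite mulrC.
Qed.

Lemma n_derivable_flat n Q a b : n_derivable n (fun x => flat Q (a * x + b)).
Proof.
have d c Q' x : derivable (fun x => c * flat Q' (a * x + b)) x 1.
  by apply: derivableM => //; case: (is_derive_flat_affine Q' a b x).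
suff H : forall c, n_derivable n (fun x => c * flat Q (a * x + b)).
  by have := H 1; under eq_fun do rewrite mul1r.
elim: n Q => [|n IH] Q c; first by split.
split => //.
have -> : derive1 (fun x => c * flat Q (a * x + b)) =
    (fun x => (c * a) * flat ('X^2 * (Q - Q^`())) (a * x + b)).
  apply/funext => x; rewrite derive1E.
  have := is_deriveZ c (is_derive_flat_affine Q a b x).
  by move=> [_ ->]; rewrite /GRing.scale/= mulrA.
exact: IH.
Qed.

End Smooth.

Section Cutoff.
Context {R : realType}.
Implicit Types (f g : R -> R) (Q : {poly R}).

Definition eflat (y : R) : R := flat 1 y.
(** The derivative of eflat. *)
Definition deflat (y : R) : R := flat 'X^2 y.

Lemma eflatE y : 0 < y -> eflat y = expR (- y^-1).
Proof. by move=> y0; rewrite /eflat /flat y0 hornerE mul1r. Qed.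

Lemma deflatE y : 0 < y -> deflat y = y^-1 ^+ 2 * expR (- y^-1).
Proof. by move=> y0; rewrite /deflat /flat y0 hornerXn. Qed.

Lemma eflat_ge0_le1 y : 0 <= eflat y <= 1.
Proof.
have [y0|y0] := ltP 0 y; last by rewrite /eflat /flat ltNge y0/= lexx ler01.
by rewrite eflatE// expR_ge0 -expR0 ler_expR oppr_le0 invr_ge0 ltW.
Qed.

Lemma deflat_ge0_le y : 0 <= deflat y /\ (0 < y -> deflat y <= y^-1 ^+ 2).
Proof.
have [y0|y0] := ltP 0 y; last by rewrite /deflat /flat ltNge y0/=.
rewrite deflatE// mulr_ge0 ?expR_ge0 ?sqr_ge0//; split => // _.
by rewrite ler_piMr ?sqr_ge0// -expR0 ler_expR oppr_le0 invr_ge0 ltW.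
Qed.

Lemma deflat_le2 y : deflat y <= 2.
Proof.
have [y0|y0] := ltP 0 y; last by rewrite /deflat /flat ltNge y0/=.
rewrite deflatE// expRN ler_pdivrMr ?expR_gt0//.
have s0 : 0 <= y^-1 by rewrite invr_ge0 ltW.
have := expR_ge1Dxn 1 s0; rewrite (_ : 2`!%:R = 2 :> R)//; lra.
Qed.

(** With s = 1/y this is (s + s^2) e^(-s) <= 1 + 2. *)
Lemma deflat_scaled_le y : 0 <= (y + 1) * deflat y <= 3.
Proof.
have [y0|y0] := ltP 0 y; last by rewrite /deflat /flat ltNge y0/= mulr0 lexx/=.
have [d0 _] := deflat_ge0_le y.
rewrite mulr_ge0 ?addr_ge0 ?(ltW y0)//= mulrDl mul1r.
have := deflat_le2 y.
suff : y * deflat y <= 1 by lra.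
rewrite deflatE//; set s := y^-1.
have -> : y * (s ^+ 2 * expR (- s)) = s * expR (- s).
  by rewrite /s; field; rewrite gt_eqF.
rewrite expRN ler_pdivrMr ?expR_gt0// mul1r.
by have := expR_ge1Dx s; lra.
Qed.

Lemma deflat_scaled_le_inv y : 0 < y -> (y + 1) * deflat y <= y^-1 + y^-1 ^+ 2.
Proof.
move=> y0; have [_ /(_ y0) H] := deflat_ge0_le y.
have y1 : 0 <= y + 1 by lra.
apply: (le_trans (ler_wpM2l y1 H)).
rewrite le_eqVlt; apply/orP; left; apply/eqP; by field; rewrite gt_eqF.
Qed.

(** Smooth, supported in [1/(n+1), n+1] and tending to 1.  Near 0 the profile is
    dilated, near infinity it is translated: this keeps x (cutoff n)'(x) below
    3 + 2x for all n, as dominated convergence requires. *)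
Definition cutoff (n : nat) (x : R) : R :=
  eflat (n.+1%:R * x + -1) * eflat (-1 * x + n.+1%:R).

Definition dcutoff (n : nat) (x : R) : R :=
  n.+1%:R * deflat (n.+1%:R * x + -1) * eflat (-1 * x + n.+1%:R)
  - eflat (n.+1%:R * x + -1) * deflat (-1 * x + n.+1%:R).

Lemma is_derive_eflat (a b x : R) :
  is_derive x 1 (fun x => eflat (a * x + b)) (a * deflat (a * x + b)).
Proof.
have := is_derive_flat_affine 1 a b x.
by rewrite derivC subr0 mulr1.
Qed.

Lemma derive1_cutoff n : derive1 (cutoff n) = dcutoff n.
Proof.
rewrite derive1M => [|x|x].
- apply/funext => x; rewrite !derive1E.
  have [_ ->] := is_derive_eflat n.+1%:R (-1) x.
  have [_ ->] := is_derive_eflat (-1) n.+1%:R x.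
  by rewrite /dcutoff; ring.
- by case: (is_derive_eflat n.+1%:R (-1) x).
- by case: (is_derive_eflat (-1) n.+1%:R x).
Qed.

Lemma n_derivable_cutoff k n : n_derivable k (cutoff n).
Proof. by apply: n_derivableM; exact: n_derivable_flat. Qed.

Lemma cutoff_ge0_le1 n x : 0 <= cutoff n x <= 1.
Proof.
have /andP[a0 a1] := eflat_ge0_le1 (n.+1%:R * x + -1).
have /andP[b0 b1] := eflat_ge0_le1 (-1 * x + n.+1%:R).
by rewrite mulr_ge0//= mulr_ile1.
Qed.

Lemma cutoff_supp n x : cutoff n x != 0 -> n.+1%:R^-1 <= x <= n.+1%:R.
Proof.
rewrite mulf_eq0 negb_or /eflat /flat => /andP[].
have [a0 _|//] := ltP 0 (n.+1%:R * x + -1); last by rewrite eqxx.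
have [b0 _|//] := ltP 0 (-1 * x + n.+1%:R); last by rewrite eqxx.
apply/andP; split; last by lra.
rewrite -[_^-1]mul1r ler_pdivrMr//; lra.
Qed.

Lemma dcutoff_le n x : 0 <= x -> `|x * dcutoff n x| <= 3 + 2 * x.
Proof.
move=> x0; have /andP[a0 a1] := eflat_ge0_le1 (n.+1%:R * x + -1).
have /andP[b0 b1] := eflat_ge0_le1 (-1 * x + n.+1%:R).
have /andP[] := deflat_scaled_le (n.+1%:R * x + -1).
rewrite addrNK /dcutoff; set u := deflat (_ * x + -1); set v := deflat _ => u0 u3.
have v2 : v <= 2 by exact: deflat_le2.
have [v0 _] := deflat_ge0_le (-1 * x + n.+1%:R); rewrite -/v in v0.
set A := eflat _ in a0 a1 *; set B := eflat _ in b0 b1 *.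
have -> : x * (n.+1%:R * u * B - A * v) = n.+1%:R * x * u * B - x * (A * v) by ring.
apply: (le_trans (ler_normB _ _)); apply: lerD.
  rewrite normrM !ger0_norm// -[leRHS]mulr1 ler_pM//.
rewrite ger0_norm ?mulr_ge0// mulrC ler_wpM2r// -[leRHS]mul1r ler_pM//.
Qed.

Lemma cvg_affine_y (x : R) : 0 < x -> (n.+1%:R * x + -1 : R) @[n --> \oo] --> +oo.
Proof.
move=> x0; apply/cvgryPge => A.
have /cvgryPge/(_ ((`|A| + 1) / x)) := @cvgr_idn R.
apply: filterS => n Hn; move: Hn; rewrite ler_pdivrMr// -natr1 mulrDl.
by have := ler_norm A; lra.
Qed.

Lemma cvg_sub_y (x : R) : (-1 * x + n.+1%:R : R) @[n --> \oo] --> +oo.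
Proof.
apply/cvgryPge => A.
have /cvgryPge/(_ (A + x)) := @cvgr_idn R.
by apply: filterS => n Hn; move: Hn; rewrite -natr1; lra.
Qed.

Lemma cvg_inv_y (u : nat -> R) : u n @[n --> \oo] --> +oo -> (u n)^-1 @[n --> \oo] --> (0 : R).
Proof.
move=> uy; have up : \forall n \near \oo, 0 < u n.
  by move/cvgryPgt : uy => /(_ 0).
exact: (gtr0_cvgV0 up).2.
Qed.

Lemma cvg_eflat_y (u : nat -> R) : u n @[n --> \oo] --> +oo ->
  eflat (u n) @[n --> \oo] --> (1 : R).
Proof.
move=> uy; have ui := cvg_inv_y uy.
have H : expR (- (u n)^-1) @[n --> \oo] --> (1 : R).
  have N0 : - (u n)^-1 @[n --> \oo] --> (0 : R) by rewrite -oppr0; exact: cvgN.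
  have := cvg_comp _ _ N0 (@continuous_expR R 0).
  by rewrite expR0.
apply: cvg_trans H; apply: near_eq_cvg.
move/cvgryPgt : uy => /(_ 0); apply: filterS => n un.
by rewrite eflatE.
Qed.

Lemma cvg_deflat_y (u : nat -> R) : u n @[n --> \oo] --> +oo ->
  (u n + 1) * deflat (u n) @[n --> \oo] --> (0 : R).
Proof.
move=> uy; have ui := cvg_inv_y uy.
have H : (u n)^-1 + (u n)^-1 ^+ 2 @[n --> \oo] --> (0 : R).
  have -> : 0 = 0 + 0 * 0 :> R by rewrite mulr0 addr0.
  by apply: cvgD => //; apply: cvgM.
apply: (squeeze_cvgr _ (cvg_cst 0) H).
move/cvgryPgt : uy => /(_ 0); apply: filterS => n un.
by rewrite deflat_scaled_le_inv// andbT; have /andP[] := deflat_scaled_le (u n).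
Qed.

Lemma cvg_deflat0_y (u : nat -> R) : u n @[n --> \oo] --> +oo ->
  deflat (u n) @[n --> \oo] --> (0 : R).
Proof.
move=> uy; apply: (squeeze_cvgr _ (cvg_cst 0) (cvg_deflat_y uy)).
move/cvgryPgt : uy => /(_ 0); apply: filterS => n un.
have [d0 _] := deflat_ge0_le (u n); rewrite d0/=.
by rewrite ler_peMl// lerDr ltW.
Qed.

Lemma cvg_cutoff x : 0 < x -> cutoff n x @[n --> \oo] --> (1 : R).
Proof.
move=> x0; rewrite -(mulr1 1); apply: cvgM.
  exact: (cvg_eflat_y (cvg_affine_y x0)).
exact: (cvg_eflat_y (cvg_sub_y x)).
Qed.

(** With y = (n+1) x - 1, the left edge contributes (y + 1) times the derivative
    of the profile at y, of order 1/y. *)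
Lemma cvg_dcutoff x : 0 < x -> x * dcutoff n x @[n --> \oo] --> (0 : R).
Proof.
move=> x0; have -> : (fun n => x * dcutoff n x) = (fun n =>
   ((n.+1%:R * x + -1 + 1) * deflat (n.+1%:R * x + -1)) * eflat (-1 * x + n.+1%:R)
   - x * (eflat (n.+1%:R * x + -1) * deflat (-1 * x + n.+1%:R))).
  by apply/funext => n; rewrite addrNK /dcutoff; ring.
rewrite [X in _ --> X](_ : 0 = 0 * 1 - x * (1 * 0)); last by rewrite !(mulr0, mul0r, subr0).
apply: cvgB; apply: cvgM.
- exact: (cvg_deflat_y (cvg_affine_y x0)).
- exact: (cvg_eflat_y (cvg_sub_y x)).
- exact: cvg_cst.
- apply: cvgM; first exact: (cvg_eflat_y (cvg_affine_y x0)).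
  exact: (cvg_deflat0_y (cvg_sub_y x)).
Qed.

Lemma test_function_cutoff n Q :
  test_function (fun x => cutoff n x * (Q.[x] * expR (- (1 * x)))).
Proof.
set phi := (X in test_function X).
have sub : supp phi `<=` `[n.+1%:R^-1, n.+1%:R]%classic.
  rewrite /supp; apply: (@subset_trans _ (closure (`[n.+1%:R^-1 : R, n.+1%:R]%classic))).
    apply: closure_subset => x /=; rewrite mulf_eq0 negb_or => /andP[/cutoff_supp].
    by rewrite in_itv.
  by have /closure_id <- := @interval_closed R (BLeft n.+1%:R^-1) (BRight n.+1%:R) isT isT.
split.
- apply: n_derivable_derive1n => k; apply: n_derivableM.
    exact: n_derivable_cutoff.
  exact: n_derivable_poly_expR.
- apply: subclosed_compact sub; last exact: segment_compact.
  exact: closed_closure.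
- move=> x /sub; rewrite /halfline/= !in_itv/= andbT => /andP[h _].
  by apply: lt_le_trans h; rewrite invr_gt0.
Qed.

End Cutoff.

(** * Weak derivatives and the decay of Laguerre coefficients *)

Lemma Rintegral_dominated d (T : measurableType d) (R : realType)
  (mu : {measure set T -> \bar R}) (D : set T) (f_ : nat -> T -> R) (f g : T -> R) :
  measurable D -> (forall n, measurable_fun D (f_ n)) -> measurable_fun D f ->
  mu.-integrable D (EFin \o g) ->
  (forall n x, D x -> `|f_ n x| <= g x) ->
  (forall x, D x -> f_ n x @[n --> \oo] --> f x) ->
  \int[mu]_(x in D) f_ n x @[n --> \oo] --> \int[mu]_(x in D) f x.
Proof.
move=> mD mf_ mf ig fg ff.
pose F_ n x := (f_ n x)%:E.
have mF_ n : measurable_fun D (F_ n) by exact/measurable_EFinP.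
have mF : measurable_fun D (EFin \o f) by exact/measurable_EFinP.
have FF x : D x -> F_ n x @[n --> \oo] --> (EFin \o f) x.
  by move=> Dx; apply: cvg_EFin; [exact: nearW|exact: ff].
have FG x n : D x -> (`|F_ n x| <= (EFin \o g) x)%E.
  by move=> Dx; rewrite /= lee_fin fg.
have [intf _ H] := dominated_convergence mD mF_ mF (aeW _ FF) ig (aeW _ FG).
apply: fine_cvg; rewrite fineK//.
exact: integrable_fin_num.
Qed.

Section WeakIBP.
Context {R : realType}.
Implicit Types (f g : R -> R) (Q P q : {poly R}).

Let mH := @measurable_halfline R.
Let mr := @measurable_rho R.
Let r0 := @rho_ge0 R.

Local Notation rho_L2 := (wL2 (leb R) (@halfline R) rho).
Local Notation rho_ip := (ip (leb R) (@halfline R) rho).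
Local Notation rho_nsq := (nsq (leb R) (@halfline R) rho).
Local Notation lag_coef := (fcoef (leb R) (@halfline R) rho lag).

(** The weight of the derivatives: ||sqrt(x) f'|| for e^(-x) is ||f'|| for
    x e^(-x). *)
Definition rho1 : lebesgueType R -> R := fun x => x * expR (- x).

Lemma measurable_rho1 : measurable_fun (@halfline R) rho1.
Proof.
apply: measurable_funTS.
apply: (@continuous_lebesgue _ (fun x : R => x * expR (- x))) => x.
have := @continuous_poly_expR R 'X 1 x; rewrite /continuous_at hornerX mul1r.
by under eq_fun do rewrite hornerX mul1r.
Qed.

Lemma rho1_ge0 x : (@halfline R) x -> 0 <= rho1 x.
Proof.
by rewrite /halfline/= in_itv/= andbT => x0; rewrite mulr_ge0 ?expR_ge0// ltW.
Qed.

Let mr1 := measurable_rho1.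
Let r10 := rho1_ge0.

Local Notation rho1_L2 := (wL2 (leb R) (@halfline R) rho1).
Local Notation rho1_ip := (ip (leb R) (@halfline R) rho1).
Local Notation rho1_nsq := (nsq (leb R) (@halfline R) rho1).

Lemma L2rho_wL2 f : L2rho f -> rho_L2 f.
Proof.
move=> [mf ff]; split => //; apply/integrableP; split.
  apply/measurable_EFinP.
  by apply: measurable_funM; [exact: measurable_funX|exact: mr].
move: ff; congr (_ < _)%E; apply: eq_integral => x _.
rewrite gee0_abs; last by rewrite lee_fin mulr_ge0 ?expR_ge0 ?sqr_ge0.
by rewrite real_normK// num_real.
Qed.

Lemma halfline_gt0 x : (@halfline R) x -> 0 < x.
Proof. by rewrite /halfline/= in_itv/= andbT. Qed.

(** Divide by sqrt(x), which does not vanish on the half-line. *)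
Lemma L2rho_measurable_deriv g : L2rho (fun x => Num.sqrt x * g x) ->
  measurable_fun (@halfline R) (g : lebesgueType R -> R).
Proof.
move=> [mg _].
apply: (@eq_measurable_fun _ _ _ _ _ (fun x : lebesgueType R =>
    (x : R) `^ (- 2^-1) * (Num.sqrt x * g x))).
  move=> x /set_mem/halfline_gt0 x0.
  by rewrite mulrA powRN powR12_sqrt ?ltW// mulVf ?mul1r// gt_eqF// sqrtr_gt0.
apply: measurable_funM; last exact: mg.
apply: measurable_funTS; apply: measurable_lebesgueT.
exact: measurable_powR.
Qed.

Lemma L2rho_wL2_rho1 g : L2rho (fun x => Num.sqrt x * g x) -> rho1_L2 g.
Proof.
move=> Lg; split; first exact: L2rho_measurable_deriv.
have [_] := L2rho_wL2 Lg; apply: eq_integrable => //.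
move=> x /set_mem/halfline_gt0 x0; rewrite exprMn sqr_sqrtr ?ltW//.
by rewrite /rho1 /rho; congr EFin; ring.
Qed.

Lemma wL2_rho1_poly Q : rho1_L2 (horner Q).
Proof.
split.
  apply: measurable_funTS; apply: continuous_lebesgue; exact: continuous_horner.
have := integrable_poly_expR ('X * Q ^+ 2) ltr01; apply: eq_integrable => //.
move=> x _; congr EFin; rewrite hornerM hornerX horner_exp mul1r /rho1 mulrA; congr (_ * _); exact: mulrC.
Qed.

Lemma wL2_norm (mu : {measure set (lebesgueType R) -> \bar R}) (w g : lebesgueType R -> R) :
  wL2 mu (@halfline R) w g -> wL2 mu (@halfline R) w (fun x => `|g x|).
Proof.
move=> [mg ig]; split; first exact: measurableT_comp.
by move: ig; congr wint; apply/funext => x; rewrite real_normK// num_real.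
Qed.

(** Test the weak derivative on x e^(-x) q(x) cut off by cutoff n, and let n tend
    to infinity.  The derivative of the cut-off comes with the factor x, hence
    is dominated and tends to 0; on the left e^(-x) dexp(X q) is the derivative
    of x e^(-x) q. *)
Lemma weak_ibp f f' q : rho_L2 f -> weak_derivative f f' -> rho1_L2 f' ->
  rho_ip f (horner (dexp ('X * q))) =
  - rho1_ip f' (horner q).
Proof.
move=> Lf [_ _ Hw] Lf'; set Q := 'X * q.
pose phi n x := cutoff n x * (Q.[x] * expR (- (1 * x))).
have dphi n : derive1 (phi n) = (fun x => dcutoff n x * (Q.[x] * expR (- x)) +
    cutoff n x * ((dexp Q).[x] * expR (- x))).
  rewrite derive1M => [|x|x].
  - rewrite derive1_cutoff derive1_poly_expR scale1r.
    by apply/funext => x; rewrite mul1r.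
  - exact: (n_derivable0 (n_derivable_cutoff 0 n)).
  - exact: (n_derivable0 (n_derivable_poly_expR 0 Q 1)).
have mphi k n : measurable_fun (@halfline R) (derive1n k (phi n) : lebesgueType R -> R).
  apply: measurable_funTS; apply: continuous_lebesgue => x.
  apply/differentiable_continuous/derivable1_diffP.
  by have [+ _ _] := test_function_cutoff n Q; apply.
have [mf _] := Lf; have [mf' _] := Lf'.
have lhs : \int[leb R]_(x in @halfline R) (f x * derive1 (phi n) x) @[n --> \oo] -->
    rho_ip f (horner (dexp Q)).
  apply: (@Rintegral_dominated _ (lebesgueType R) R (leb R) (@halfline R) (fun n x => f x * derive1 (phi n) x) _
    (fun x => `|f x| * (`|(q * (3%:P + 2 *: 'X)).[x]| + `|(dexp Q).[x]|) * rho x) mH).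
  - move=> n; by apply: measurable_funM; [exact: mf|exact: (mphi 1%N n)].
  - apply: measurable_funM; last exact: mr.
    by apply: measurable_funM; [exact: mf|have [] := wL2_poly (dexp Q)].
  - apply: (wL2_wintM mH mr (wL2_norm Lf)).
    exact: (wL2D mH mr (wL2_norm (wL2_poly _)) (wL2_norm (wL2_poly _))).
  - move=> n x /halfline_gt0 x0; rewrite normrM -mulrA ler_wpM2l//.
    rewrite dphi (le_trans (ler_normD _ _))// [leRHS]mulrDl; apply: lerD.
      rewrite /Q hornerM hornerX.
      have -> : dcutoff n x * (x * q.[x] * expR (- x)) =
         (x * dcutoff n x) * q.[x] * expR (- x) by ring.
      rewrite normrM (ger0_norm (expR_ge0 _)) ler_wpM2r ?expR_ge0//.
      rewrite hornerM !normrM mulrC ler_wpM2l// -normrM.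
      rewrite hornerD hornerC hornerZ hornerX (le_trans (dcutoff_le n (ltW x0)))//.
      exact: ler_norm.
    have /andP[c0 c1] := cutoff_ge0_le1 n x.
    rewrite normrM (ger0_norm c0) normrM (ger0_norm (expR_ge0 _)).
    by rewrite ler_piMl// mulr_ge0 ?expR_ge0.
  - move=> x /halfline_gt0 x0.
    have -> : (fun n => f x * derive1 (phi n) x) = (fun n =>
       f x * ((x * dcutoff n x) * (q.[x] * expR (- x)) +
             cutoff n x * ((dexp Q).[x] * expR (- x)))).
      apply/funext => n; rewrite dphi /Q hornerM hornerX; ring.
    have -> : f x * (dexp Q).[x] * rho x =
       f x * (0 * (q.[x] * expR (- x)) + 1 * ((dexp Q).[x] * expR (- x))).
      by rewrite mul0r add0r mul1r mulrA.
    apply: cvgMr; apply: cvgD; apply: cvgMl.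
      exact: cvg_dcutoff.
    exact: cvg_cutoff.
have rhs : \int[leb R]_(x in @halfline R) (f' x * phi n x) @[n --> \oo] -->
    rho1_ip f' (horner q).
  apply: (@Rintegral_dominated _ (lebesgueType R) R (leb R) (@halfline R) (fun n x => f' x * phi n x) _
    (fun x => `|f' x| * `|q.[x]| * rho1 x) mH).
  - move=> n; by apply: measurable_funM; [exact: mf'|exact: (mphi 0%N n)].
  - apply: measurable_funM; last exact: mr1.
    by apply: measurable_funM; [exact: mf'|have [] := wL2_poly q].
  - apply: (wL2_wintM mH mr1 (wL2_norm Lf')).
    by apply: wL2_norm; exact: wL2_rho1_poly.
  - move=> n x /halfline_gt0 x0; rewrite normrM -mulrA ler_wpM2l//.
    have /andP[c0 c1] := cutoff_ge0_le1 n x.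
    rewrite /phi /Q hornerM hornerX mul1r normrM (ger0_norm c0) !normrM.
    rewrite (gtr0_norm x0) (ger0_norm (expR_ge0 _)) /rho1.
    rewrite mulrCA mulrA [X in _ <= X](_ : _ = x * `|q.[x]| * expR (- x)); last by ring.
    have -> : x * `|q.[x]| * cutoff n x * expR (- x) = cutoff n x * (x * `|q.[x]| * expR (- x)) by ring.
    by rewrite ler_piMl// !mulr_ge0 ?expR_ge0// ltW.
  - move=> x /halfline_gt0 x0.
    have -> : f' x * q.[x] * rho1 x = f' x * (1 * (Q.[x] * expR (- (1 * x)))).
      by rewrite /Q hornerM hornerX /rho1 !mul1r; ring.
    by apply: cvgMr; apply: cvgMl; exact: cvg_cutoff.
have E : (fun n => \int[leb R]_(x in @halfline R) (f x * derive1 (phi n) x)) =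
   (fun n => - \int[leb R]_(x in @halfline R) (f' x * phi n x)).
  by apply/funext => n; apply: Hw; exact: test_function_cutoff.
rewrite E in lhs; rewrite -(cvg_lim (@Rhausdorff R) lhs); apply: cvg_lim => //; exact: cvgN.
Qed.

(** Indexed from L_1, since L_0' = 0. *)
Definition dlag k : lebesgueType R -> R :=
  fun x => (Num.sqrt k.+1%:R)^-1 * (laguerre_poly k.+1)^`().[x].

Local Notation dlag_coef := (fcoef (leb R) (@halfline R) rho1 dlag).

Lemma sqrt_neq0 k : Num.sqrt k.+1%:R != 0 :> R.
Proof. by rewrite gt_eqF// sqrtr_gt0. Qed.

Lemma wL2_rho1_dlag k : rho1_L2 (dlag k).
Proof. by apply: wL2Z => //; exact: wL2_rho1_poly. Qed.

Lemma ip_dlag j k : rho1_ip (dlag j) (dlag k) = (j == k)%:R.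
Proof.
rewrite /dlag (ipZl mH mr1 _ (wL2_rho1_poly _) (wL2_rho1_dlag k)).
rewrite ipC (ipZl mH mr1 _ (wL2_rho1_poly _) (wL2_rho1_poly _)).
have -> : rho1_ip (horner (laguerre_poly k.+1)^`())
    (horner (laguerre_poly j.+1)^`()) = j.+1%:R * (k.+1 == j.+1)%:R.
  rewrite -laguerre_deriv_ortho -Rintegral_poly_expR//.
  apply: eq_Rintegral => x _; rewrite !hornerM hornerX mul1r /rho1; ring.
rewrite eqSS; have [->|_] := eqVneq k j; last by rewrite !mulr0.
rewrite mulr1 -[X in _ * (_ * X)](sqr_sqrtr (ler0n R j.+1)).
rewrite (_ : true%:R = 1 :> R)//; field; exact: sqrt_neq0.
Qed.

(** Laguerre's equation: dexp(X L_k') = - k L_k. *)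
Lemma fcoef_dlag f f' k : rho_L2 f -> weak_derivative f f' -> rho1_L2 f' ->
  dlag_coef f' k =
  Num.sqrt k.+1%:R * lag_coef f k.+1.
Proof.
move=> Lf Hw Lf'; rewrite /fcoef /dlag ipC (ipZl mH mr1 _ (wL2_rho1_poly _) Lf').
rewrite ipC -[ip _ _ rho1 _ _]opprK -(weak_ibp _ Lf Hw Lf').
have -> : dexp ('X * (laguerre_poly k.+1)^`()) = - k.+1%:R *: laguerre_poly k.+1 :> {poly R}.
  have /= H := laguerre_ode k.+1 : _ = 0 :> {poly R}.
  apply/eqP; rewrite scaleNr -addr_eq0; apply/eqP; rewrite -[RHS]H /dexp derivM derivX; ring.
rewrite ipC.
have -> : horner (- k.+1%:R *: laguerre_poly k.+1) =
   (fun x => - k.+1%:R * lag k.+1 x) :> (R -> R).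
  by apply/funext => x; rewrite hornerZ.
rewrite (ipZl mH mr _ (wL2_lag _) Lf).
rewrite ipC mulNr opprK mulrA; congr (_ * _).
rewrite -[X in _ * X](sqr_sqrtr (ler0n R k.+1)).
by field; exact: sqrt_neq0.
Qed.

Lemma sum_weighted_coef_le f f' n : rho_L2 f -> weak_derivative f f' ->
  L2rho (fun x => Num.sqrt x * f' x) ->
  \sum_(k < n) k%:R * lag_coef f k ^+ 2
  <= rho_nsq (fun x => Num.sqrt x * f' x).
Proof.
move=> Lf Hw Lg; have Lf' := L2rho_wL2_rho1 Lg.
have E : rho_nsq (fun x => Num.sqrt x * f' x) = rho1_nsq f'.
  apply: eq_Rintegral => x /set_mem/halfline_gt0 x0.
  rewrite -expr2 exprMn sqr_sqrtr ?ltW// /rho1 /rho; ring.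
rewrite E; case: n => [|n]; first by rewrite big_ord0; exact: (nsq_ge0 _ r10).
rewrite big_ord_recl mul0r add0r.
apply: le_trans (bessel mH mr1 r10 wL2_rho1_dlag ip_dlag n Lf').
rewrite le_eqVlt; apply/orP; left; apply/eqP; apply: eq_bigr => k _.
by rewrite (fcoef_dlag _ Lf Hw Lf') exprMn sqr_sqrtr.
Qed.

End WeakIBP.

(** * The error estimate *)

Section Assembly.
Context {R : realType}.
Implicit Types (f g : R -> R) (P : {poly R}).

Let mH := @measurable_halfline R.
Let mr := @measurable_rho R.
Let r0 := @rho_ge0 R.

Local Notation rho_L2 := (wL2 (leb R) (@halfline R) rho).
Local Notation rho_nsq := (nsq (leb R) (@halfline R) rho).
Local Notation lag_coef := (fcoef (leb R) (@halfline R) rho lag).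

Lemma L2rho_normsqE g : rho_L2 g -> L2rho_normsq g = (rho_nsq g)%:E.
Proof.
move=> [mg ig]; rewrite /nsq /ip /Rintegral /L2rho_normsq.
have E : (\int[leb R]_(x in @halfline R) (`|g x| ^+ 2 * expR (- x))%:E =
    \int[leb R]_(x in @halfline R) (g x * g x * rho x)%:E)%E.
  by apply: eq_integral => x _; rewrite real_normK ?num_real// expr2.
rewrite E fineK//; apply: integrable_fin_num => //.
Qed.

Lemma lcoef_bounded f : rho_L2 f -> bounded_seq_by (Num.sqrt (rho_nsq f)) (lag_coef f).
Proof.
move=> Lf k; have f0 : 0 <= rho_nsq f by exact: nsq_ge0.
rewrite -sqrtr_sqr ler_sqrt//.
apply: le_trans (bessel mH mr r0 (@wL2_lag R) (@ip_lag R) k.+1 Lf).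
by rewrite big_ord_recr/= lerDr sumr_ge0// => i _; rewrite sqr_ge0.
Qed.

Lemma lincomb_wide (c : nat -> R) n N : (n <= N)%N ->
  (forall k, (n <= k)%N -> c k = 0) -> lincomb (@lag R) c n = lincomb (@lag R) c N.
Proof.
move=> nN c0; apply/funext => x; rewrite /lincomb.
rewrite (big_ord_widen N (fun k => c k * lag k x))// big_mkcond/=.
by apply: eq_bigr => k _; case: ltnP => // /c0 ->; rewrite mul0r.
Qed.

(** By completeness the part of f beyond degree N has arbitrarily small norm, so a
    bound on the finite sums uniform in N suffices. *)
Lemma nsq_sub_Phi_inv_le f P B : rho_L2 f ->
  (forall N, (size P <= N)%N -> \sum_(k < N) (lag_coef f k - P`_k) ^+ 2 <= B) ->
  rho_nsq (fun x => f x - Phi_inv P x) <= B.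
Proof.
move=> Lf HB; apply/ler_addgt0Pr => e e0.
have [_ /(_ _ e0)[n0 Hn0]] := laguerre_complete Lf.
pose N := maxn n0 (size P).
rewrite Phi_invE (@lincomb_wide _ _ N) ?leq_maxr//; last first.
  by move=> k sk; rewrite nth_default.
rewrite (nsq_sub_lincomb mH mr (@wL2_lag R) (@ip_lag R))// -/(resid _ _ _ _ _ _).
rewrite addrC; apply: lerD; first by apply: HB; exact: leq_maxr.
apply: ltW; apply: le_lt_trans Hn0; apply: resid_decr; exact: leq_maxl.
Qed.

Lemma sum_indicator_le (c : pred nat) (y : R) N : 0 <= y ->
  (forall k, c k -> k%:R <= y) -> \sum_(k < N) (c k)%:R <= 1 + y.
Proof.
move=> y0 cy.
suff : \sum_(k < N) (c k)%:R <= N%:R :> R /\ \sum_(k < N) (c k)%:R <= 1 + y by case.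
elim: N => [|N [IH1 IH2]]; first by rewrite big_ord0; split; lra.
rewrite big_ord_recr/= -natr1; case: (boolP (c N)) => [/cy cN|_] /=; split; lra.
Qed.

Lemma lagrange_interpB (a nu1 nu2 : nat -> R) m : injective a ->
  lagrange_interp a nu1 m =
  lagrange_interp a nu2 m - lagrange_interp a (fun j => nu2 j - nu1 j) m.
Proof.
move=> ainj; apply: is_lagrange_interp_unique (ainj) (lagrange_interpP _ _ ainj) _.
have [s2 e2] := lagrange_interpP nu2 m ainj.
have [s3 e3] := lagrange_interpP (fun j => nu2 j - nu1 j) m ainj.
split=> [|j jm].
  by rewrite (leq_trans (size_polyD _ _))// size_polyN geq_max s2.
by rewrite hornerD hornerN e2// e3// opprB addrC subrK.
Qed.

Lemma coef_truncated_lagrange (th : R) a nu m k :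
  (truncated_lagrange th a nu m)`_k =
  if (k < m)%N && (k%:R <= th * (m%:R - 1)) then (lagrange_interp a nu m)`_k else 0.
Proof.
rewrite /truncated_lagrange coef_sum.
case: (ltnP k m) => [km|mk] /=; last first.
  rewrite big1// => i _; rewrite coefZ coefXn gtn_eqF ?mulr0//.
  exact: leq_trans (ltn_ord i) mk.
rewrite big_mkcond (bigD1 (Ordinal km))//= big1 ?addr0 => [|i ik].
  by case: ifP => // _; rewrite coefZ coefXn eqxx mulr1.
case: ifP => // _; rewrite coefZ coefXn; case: eqP => [e|]; last by rewrite mulr0.
by case/eqP: ik; apply/val_inj.
Qed.

Lemma theta0_lt1 (sigma theta0 : R) : 0 < sigma < 1 / 3 ->
  2 * sigma `^ (1 - theta0) / (1 - sigma) = 1 -> theta0 < 1.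
Proof.
move=> /andP[s0 s3] H; rewrite ltNge; apply/negP => t1.
have : sigma `^ 0 <= sigma `^ (1 - theta0).
  by apply: ger_powR; rewrite ?s0 ?subr_le0//; lra.
have s1 : 0 < 1 - sigma by lra.
have : 2 * sigma `^ (1 - theta0) = 1 - sigma.
  by have := congr1 (fun z => z * (1 - sigma)) H; rewrite divfK ?mul1r ?gt_eqF.
by rewrite powRr0; lra.
Qed.

(** If k >= m this is th <= 1.  Otherwise k > th (m-1), which is at least
    th m / 2 when m >= 2, while k >= 1 when m = 1. *)
Lemma tail_weight (th : R) (m k : nat) : (1 <= m)%N -> 0 < th <= 1 ->
  ~~ ((k < m)%N && (k%:R <= th * (m%:R - 1))) -> 1 <= 2 / (m%:R * th) * k%:R.
Proof.
move=> m1 /andP[t0 t1] H.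
have m0 : 1 <= m%:R :> R by rewrite ler1n.
have mt : 0 < m%:R * th by rewrite mulr_gt0// ltr0n.
rewrite mulrAC ler_pdivlMr// mul1r.
move: H; rewrite negb_and -leqNgt -ltNge => /orP[mk|kt].
  have : m%:R <= k%:R :> R by rewrite ler_nat.
  nra.
have k0 : 0 < k%:R :> R by apply: le_lt_trans kt; nra.
have k1 : 1 <= k%:R :> R by rewrite ler1n -(ltr0n R).
have [m2|m2] := leqP 2 m.
  have : 2 <= m%:R :> R by rewrite ler_nat.
  nra.
have -> : m = 1%N by lia.
nra.
Qed.

Lemma eps_powR (eps X : R) : 0 < eps -> 0 <= X -> X <= eps `^ (- (3 / 4)) ->
  (eps * X) ^+ 2 <= eps `^ (1 / 2).
Proof.
move=> e0 X0 XE.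
have H : eps * X <= eps `^ (1 / 4).
  rewrite (_ : 1 / 4 = 1 + - (3 / 4)); last by lra.
  rewrite powRD; last by rewrite (gt_eqF e0) implybT.
  by rewrite (powRr1 (ltW e0)) ler_wpM2l// ltW.
rewrite (_ : 1 / 2 = 1 / 4 * 2%:R); last by lra.
rewrite powRrM powR_mulrn ?powR_ge0// lerXn2r ?nnegrE ?powR_ge0//.
by rewrite mulr_ge0// ltW.
Qed.

End Assembly.

Theorem theorem3 (R : realType) (sigma : R) (hsigma : 0 < sigma < 1 / 3)
  (f f' : R -> R) (hf : L2rho f) (hff' : weak_derivative f f')
  (hf' : L2rho (fun x => Num.sqrt x * f' x))
  (p : nat -> R) (p_inj : injective p) (p_gt : forall j, 1 / 2 < p j)
  (p_sigma : forall j, `|1 - (p j)^-1| <= sigma)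
  (theta0 : R) (htheta0 : 2 * sigma `^ (1 - theta0) / (1 - sigma) = 1)
  (psi : R -> R)
  (psi_incr : {in `[0, +oo[ &, {homo psi : x y / x < y}})
  (psi_ge : forall k : nat, (1 <= k)%N ->
     k%:R * interp_const (alpha p) k <= psi k%:R)
  (eps : R) (eps_gt0 : 0 < eps)
  (t : R) (t_ge0 : 0 <= t) (psi_t : psi t = eps `^ (- (3 / 4)))
  (m : nat) (m_def : m%:Z = Num.floor t - 1) (m_ge1 : (1 <= m)%N)
  (mu : nat -> R)
  (hmu : (ereal_sup (range (fun j => `|p j * (laplace f (p j) - mu j)|%:E))
          < eps%:E)%E)
  (theta : R) (htheta : 0 < theta < theta0) :
  (L2rho_normsq (f \- Phi_inv (truncated_lagrange theta (alpha p)
                                (fun j => p j * mu j) m))%R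
   <= (2 * (1 + m%:R * theta) ^+ 2)%R%:E * L2rho_normsq f
        * ((2 * sigma `^ (1 - theta) / (1 - sigma)) ^+ (2 * m))%R%:E
      + (2 / (m%:R * theta))%R%:E * L2rho_normsq (fun x => Num.sqrt x * f' x)%R
      + (2 * eps `^ (1 / 2))%R%:E)%E.
Proof.
have Lf := L2rho_wL2 hf; have Lf' := L2rho_wL2 hf'.
have /andP[s0 s3] := hsigma; have /andP[th0 tht] := htheta.
have th1 : theta <= 1 by rewrite ltW// (lt_trans tht)// (theta0_lt1 hsigma htheta0).
have s01 : 0 < sigma < 1 by rewrite s0; lra.
set nu := fun j => p j * mu j.
set T := truncated_lagrange _ _ _ _.
set q := 2 * sigma `^ (1 - theta) / (1 - sigma).
have mH := @measurable_halfline R.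
have mr := @measurable_rho R.
have LP : wL2 (leb R) (@halfline R) rho (Phi_inv T).
  by rewrite Phi_invE; apply: wL2_lincomb => //; exact: wL2_lag.
rewrite !L2rho_normsqE//; last exact: wL2B.
rewrite -!EFinM -!EFinD lee_fin.
set F := nsq (leb R) (@halfline R) rho f.
set G := nsq (leb R) (@halfline R) rho (fun x => Num.sqrt x * f' x).
have F0 : 0 <= F by apply: nsq_ge0; exact: rho_ge0.
have ainj : injective (alpha p).
  by move=> i j /eqP; rewrite /alpha (inj_eq (addrI _)) (inj_eq oppr_inj) (inj_eq invr_inj) => /eqP/p_inj.
have p0 j : p j != 0 by have := p_gt j; lra.
pose a := fcoef (leb R) (@halfline R) rho lag f.
have aA : bounded_seq_by (Num.sqrt F) a by exact: lcoef_bounded.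
pose nu0 j := pser a (alpha p j).
have nu0E j : nu0 j = p j * laplace f (p j) by exact: laplace_pser.
pose d j := nu0 j - nu j.
have d_eps j : `|d j| <= eps.
  rewrite /d nu0E -mulrBr -lee_fin; apply: ltW; apply: le_lt_trans hmu.
  by apply: ereal_sup_ubound; exists j.
pose P0 := lagrange_interp (alpha p) nu0 m.
pose Pd := lagrange_interp (alpha p) d m.
have PE : lagrange_interp (alpha p) nu m = P0 - Pd by exact: lagrange_interpB.
have q0 : 0 <= q by rewrite divr_ge0 ?mulr_ge0 ?powR_ge0//; lra.
(* m < t since m = [t] - 1, so psi m <= psi t = eps^(-3/4). *)
have noise : \sum_(k < m) Pd`_k ^+ 2 <= eps `^ (1 / 2).
  apply: (le_trans (interp_noise m ainj d_eps)); apply: eps_powR => //.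
    by rewrite mulr_ge0// /interp_const; apply: bigmax_ge_id.
  rewrite -psi_t (le_trans (psi_ge m m_ge1))// ltW//.
  apply: psi_incr; rewrite ?in_itv/= ?andbT//.
  have := floor_le t; have -> : Num.floor t = m%:Z + 1 by rewrite m_def subrK.
  rewrite intrD; lra.
have mth : 0 <= m%:R * theta by rewrite mulr_ge0// ltW.
pose c k := (k < m)%N && (k%:R <= theta * (m%:R - 1)).
(* (x + y)^2 <= 2 x^2 + 2 y^2 separates the interpolation error from the
   noise; the tail needs no such factor. *)
have term k : (a k - T`_k) ^+ 2 <=
   2 * F * q ^+ (2 * m) * (c k)%:R + 2 * (if (k < m)%N then Pd`_k ^+ 2 else 0)
   + 2 / (m%:R * theta) * (k%:R * a k ^+ 2).
  have tail0 : 0 <= 2 / (m%:R * theta) * (k%:R * a k ^+ 2).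
    by rewrite mulr_ge0 ?divr_ge0 ?mth// mulr_ge0 ?sqr_ge0.
  rewrite /T coef_truncated_lagrange -/(c k).
  case: (boolP (c k)) => [ck|ck]; last first.
    have tl : a k ^+ 2 <= 2 / (m%:R * theta) * (k%:R * a k ^+ 2).
      rewrite mulrA -[leLHS]mul1r ler_wpM2r ?sqr_ge0//.
      by apply: tail_weight => //; rewrite th0.
    have if0 : 0 <= 2 * (if (k < m)%N then Pd`_k ^+ 2 else 0) :> R.
      by rewrite mulr_ge0//; case: ifP => // _; rewrite sqr_ge0.
    by rewrite subr0 (_ : false%:R = 0 :> R)// mulr0 add0r; lra.
  have /andP[km kth] := ck.
  rewrite km (_ : true%:R = 1 :> R)// mulr1 PE coefB.
  have H : `|a k - P0`_k| <= Num.sqrt F * q ^+ m.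
    exact: (interp_coef_error_powR s01 p_sigma ainj aA
      (lagrange_interpP nu0 m ainj) (ltW th0) km kth).
  have : (a k - P0`_k) ^+ 2 <= F * q ^+ (2 * m).
    rewrite -(sqr_sqrtr F0) mulnC exprM -exprMn -(real_normK (num_real (a k - P0`_k))).
    by rewrite lerXn2r ?nnegrE ?mulr_ge0 ?sqrtr_ge0 ?exprn_ge0.
  move: tail0; set tl := _ / _ * _; have := sqr_ge0 (a k - P0`_k - Pd`_k).
  by rewrite !expr2; nra.
apply: nsq_sub_Phi_inv_le => // N sN.
have /le_trans : \sum_(k < N) (a k - T`_k) ^+ 2 <= \sum_(k < N) (
   2 * F * q ^+ (2 * m) * (c k)%:R + 2 * (if (k < m)%N then Pd`_k ^+ 2 else 0)
   + 2 / (m%:R * theta) * (k%:R * a k ^+ 2)).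
  by apply: ler_sum => k _; exact: term.
apply; rewrite !big_split/= -!mulr_sumr.
have tailN : \sum_(k < N) k%:R * a k ^+ 2 <= G by exact: sum_weighted_coef_le.
have noiseN : \sum_(k < N) (if (k < m)%N then Pd`_k ^+ 2 else 0) <= eps `^ (1 / 2).
  apply: le_trans noise.
  rewrite (big_ord_widen (N + m) (fun k => Pd`_k ^+ 2)) ?leq_addl//.
  rewrite [leRHS]big_mkcond big_split_ord/= lerDl sumr_ge0// => k _.
  by case: ifP => // _; rewrite sqr_ge0.
have cN : \sum_(k < N) (c k)%:R <= 1 + m%:R * theta.
  have y0 : 0 <= theta * (m%:R - 1) by rewrite mulr_ge0 ?subr_ge0 ?ler1n// ltW.
  apply: (le_trans (sum_indicator_le N y0 _)); first by move=> k /andP[].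
  by rewrite lerD2l mulrBr mulr1 mulrC; lra.
have cN2 : \sum_(k < N) (c k)%:R <= (1 + m%:R * theta) ^+ 2.
  by apply: (le_trans cN); rewrite expr2 ler_peMl//; lra.
have Fq : 0 <= 2 * F * q ^+ (2 * m) by rewrite !mulr_ge0 ?exprn_ge0.
have := ler_wpM2l Fq cN2.
have mth2 : 0 <= 2 / (m%:R * theta) by rewrite divr_ge0.
have := ler_wpM2l mth2 tailN.
lra.
Qed.
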